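(* Let $n\ge1$, let $D=\{(\alpha,\beta)\in\mathbb{R}^2\mid\alpha=\beta\}$, and let $F\colon\mathbb{R}\times(\mathbb{R}^2\setminus D)\times\mathbb{R}^{2n}\to\mathbb{R}^n$ be a mapping. Then $F$ is the smooth dependence of the solution on Neumann conditions for some smooth N-solvable equation $\ddot{x}=f(\tau,x,\dot{x})$ (with $f\colon\mathbb{R}\times\mathbb{R}^n\times\mathbb{R}^n\to\mathbb{R}^n$ smooth) if and only if the following three conditions hold: (i) for all $\tau,\gamma,\delta,\alpha,\beta\in\mathbb{R}$ with $\alpha\ne\beta$, $\gamma\ne\delta$ and all $a,b\in\mathbb{R}^n$, $F(\tau,\alpha,\beta,a,b)=F(\tau,\gamma,\delta,F(\gamma,\alpha,\beta,a,b),F(\delta,\alpha,\beta,a,b))$; (ii) for all $\alpha\ne\beta$ and $a,b\in\mathbb{R}^n$, $F(\alpha,\alpha,\beta,a,b)=a$ and $F(\beta,\alpha,\beta,a,b)=b$; (iii) the mapping $\mathbb{R}\times(\mathbb{R}^2\setminus D)\times\mathbb{R}^{2n}\ni(\tau,\alpha,\beta,a,v)\mapsto F(\tau,\alpha,\beta,a,a+v(\beta-\alpha))\in\mathbb{R}^n$ has a smooth extension $S$ to $\mathbb{R}^{2n+3}$.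
   Context: Smooth means $C^\infty$. For a smooth $f\colon\mathbb{R}\times\mathbb{R}^n\times\mathbb{R}^n\to\mathbb{R}^n$, a complete solution of $\ddot{x}=f(\tau,x,\dot{x})$ is a solution $x$ defined on all of $\mathbb{R}$. The equation is N-solvable if for every $\alpha,\beta\in\mathbb{R}$ with $\alpha\neq\beta$ and every $a,b\in\mathbb{R}^n$ there exists a unique complete solution with $x(\alpha)=a$, $x(\beta)=b$ (Neumann conditions). A mapping $F\colon\mathbb{R}\times(\mathbb{R}^2\setminus D)\times\mathbb{R}^{2n}\to\mathbb{R}^n$ is called a dependence of the solution on Neumann conditions for this equation if $F(\tau,\alpha,\beta,x(\alpha),x(\beta))=x(\tau)$ for all $\alpha\neq\beta$, all $\tau\in\mathbb{R}$ and every complete solution $x$ of the equation; it is a smooth dependence if moreover $F$ is smooth. *)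

(* Defs.v *)
From HB Require Import structures.
From mathcomp Require Import all_boot all_order all_algebra.
From mathcomp Require Import all_classical all_reals all_analysis.
Set Implicit Arguments. Unset Strict Implicit. Unset Printing Implicit Defensive.
Import Order.TTheory GRing.Theory Num.Theory.
Import numFieldNormedType.Exports.
Local Open Scope classical_set_scope.
Local Open Scope ring_scope.

Section Smooth.
Variable R : realType.

(* C^j on a set U (meant to be open) for maps between normed R-modules
   (here always finite-dimensional): all iterated directional derivatives
   up to order j exist at the points of U and are continuous there. *)
Fixpoint Ck_on (V W : normedModType R) (U : set V) (j : nat) (f : V -> W)
    : Prop :=
  match j with
  | O => {in U, continuous f}
  | S j' => {in U, continuous f} /\
            (forall x, U x -> forall v : V, derivable f x v) /\
            (forall v : V, Ck_on U j' (fun x => 'D_v f x))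
  end.

Definition smooth_on (V W : normedModType R) (U : set V) (f : V -> W) :=
  forall j, Ck_on U j f.

Definition smooth (V W : normedModType R) (f : V -> W) := smooth_on setT f.

Variable n : nat.
Notation vec := 'rV[R]_n.

Definition complete_solution (f : R -> vec -> vec -> vec) (x : R -> vec) :=
  forall t : R, derivable x t 1 /\
    derivable (fun s => 'D_1 x s) t 1 /\
    'D_1 (fun s => 'D_1 x s) t = f t (x t) ('D_1 x t).

Definition N_solvable (f : R -> vec -> vec -> vec) :=
  forall (alpha beta : R) (a b : vec), alpha <> beta ->
    exists! x, complete_solution f x /\ x alpha = a /\ x beta = b.

(* F is given on all of R^3 x R^2n, but only its values off the
   diagonal alpha = beta matter. *)
Definition dependence (F : R -> R -> R -> vec -> vec -> vec)
    (f : R -> vec -> vec -> vec) :=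
  forall (alpha beta tau : R) (x : R -> vec), alpha <> beta ->
    complete_solution f x -> F tau alpha beta (x alpha) (x beta) = x tau.

Definition offdiag : set (R * R * R * vec * vec) :=
  [set z | z.1.1.1.2 <> z.1.1.2].

Definition uncurry5 (F : R -> R -> R -> vec -> vec -> vec)
    (z : R * R * R * vec * vec) : vec :=
  F z.1.1.1.1 z.1.1.1.2 z.1.1.2 z.1.2 z.2.

Definition smooth_dependence F f :=
  dependence F f /\ smooth_on offdiag (uncurry5 F).

Definition uncurry3 (f : R -> vec -> vec -> vec) (z : R * vec * vec) : vec :=
  f z.1.1 z.1.2 z.2.

End Smooth.

(* Main.v *)
(** From the extension to the equation, let [f(t, a, v)] be the second derivative in the
    first variable of [S] at [(t, t, t, a, v)]. Letting [delta] tend to [gamma] in (i) gives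
    [x(tau) = S(tau, gamma, gamma, x(gamma), x'(gamma))] for [x = F(., alpha, beta, a, b)], so
    that [x] solves the equation. The same limits show that [S(., gamma, gamma, a, v)] is the
    solution with initial data [(a, v)] at [gamma]; uniqueness of initial value problems
    then forces every complete solution to have this form, and (i) identifies it with
    a value of [F].

    Conversely, fix [delta] and look for the end value [c = x(delta)] of the solution with
    [x(alpha) = a] and [x(beta) = a + (beta - alpha) v]. It is determined by
    [int_0^1 x'(alpha + s (beta - alpha)) ds = v], where [x = F(., alpha, delta, a, c)]; this
    equation is smooth across [alpha = beta], where it reads [x'(alpha) = v]. Gronwall's
    inequality makes its differential in [c] injective there, so [c] depends smoothly on
    [(alpha, beta, a, v)], and [S(tau, alpha, beta, a, v) = F(tau, alpha, delta, a, c)]. That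
    every initial velocity [v] occurs follows by minimising [|x'(alpha) - v|^2] over [c] for
    [delta] so close to [alpha] that solutions with bounded initial velocity stay bounded. *)

(* In the converse nothing bounds the growth of [f], so a solution with given initial data might
   blow up in finite time. Complete solutions are therefore taken only from N-solvability, and a
   prescribed initial velocity is reached by varying an end value. On the diagonal [F] says nothing;
   what is known is its smoothness at pairs of distinct times. This is the purpose of the auxiliary
   time [delta]: solutions are recorded by their values at [alpha] and [delta], which stay apart
   while [beta] crosses [alpha].

   Zeros, both of the local equation for [c] and of the global one for the initial velocity, come
   from one minimisation principle: an interior minimum of [sqn (g c)] is a zero of [g] when the
   differential of [g] is surjective. Uniqueness of the solution with given data identifies the zero
   found with the wanted value. This yields continuity of [c], which is raised to smoothness by
   differentiating the equation. *)
Require Import Defs.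
From HB Require Import structures.
From mathcomp Require Import all_boot all_order all_algebra.
From mathcomp Require Import all_classical all_reals all_analysis.
From mathcomp Require Import ring lra.
Import Order.TTheory GRing.Theory Num.Theory.
Import numFieldNormedType.Exports.
Set Implicit Arguments. Unset Strict Implicit. Unset Printing Implicit Defensive.
Local Open Scope classical_set_scope.
Local Open Scope ring_scope.

(** * A reflexive decision procedure for identities in modules *)

Section LmodReflection.
Variables (K : realType) (M : lmodType K).

Inductive lexp := LZero | LVar of nat | LAdd of lexp & lexp | LOpp of lexp
  | LScale of K & lexp.

Fixpoint leval (env : seq M) (e : lexp) : M :=
  match e with
  | LZero => 0
  | LVar i => nth 0 env i
  | LAdd a b => leval env a + leval env b
  | LOpp a => - leval env a
  | LScale r a => r *: leval env a
  end.

Fixpoint lcoef (e : lexp) (i : nat) : K :=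
  match e with
  | LZero => 0
  | LVar j => if Nat.eqb i j then 1 else 0
  | LAdd a b => lcoef a i + lcoef b i
  | LOpp a => - lcoef a i
  | LScale r a => r * lcoef a i
  end.

(** On a concrete length this computes to a plain conjunction, one scalar identity per atom, on
    which [ring] and [field] can be run. *)
Fixpoint lall (P : nat -> Prop) (i n : nat) : Prop :=
  if n is n'.+1 then P i /\ lall P i.+1 n' else True.

Lemma levalE env e :
  leval env e = \sum_(i < size env) lcoef e i *: nth 0 env i.
Proof.
elim: e => [|j|a IHa b IHb|a IHa|r a IHa] /=.
- by rewrite big1// => i _; rewrite scale0r.
- have [js|sj] := ltnP j (size env).
    rewrite (bigD1 (Ordinal js))//= big1 ?addr0.
      by rewrite PeanoNat.Nat.eqb_refl scale1r.
    move=> i /negP ij; case: PeanoNat.Nat.eqb_spec => [e|]; last by rewrite scale0r.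
    by exfalso; apply: ij; apply/eqP/val_inj.
  (* An index outside the environment stands for the default [0] and matches no summand. *)
  rewrite nth_default// big1// => i _.
  case: PeanoNat.Nat.eqb_spec => [e|]; last by rewrite scale0r.
  by move: (ltn_ord i); rewrite e ltnNge sj.
- by rewrite IHa IHb -big_split; apply: eq_bigr => i _; rewrite scalerDl.
- by rewrite IHa -sumrN; apply: eq_bigr => i _; rewrite scaleNr.
- by rewrite IHa scaler_sumr; apply: eq_bigr => i _; rewrite scalerA.
Qed.

Lemma lall_ltn P i n k : lall P i n -> (k < n)%N -> P (i + k)%N.
Proof.
elim: n i k => // n IH i [|k] /= [Pi h]; first by rewrite addn0.
by rewrite ltnS addnS -addSn; exact: IH.
Qed.

Lemma lmod_reflection env e1 e2 :
  lall (fun i => lcoef e1 i = lcoef e2 i) 0 (size env) ->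
  leval env e1 = leval env e2.
Proof.
move=> h; rewrite !levalE; apply: eq_bigr => i _.
by have := lall_ltn h (ltn_ord i); rewrite add0n => ->.
Qed.

End LmodReflection.

Ltac lmod_find t env :=
  lazymatch env with
  | nil => constr:(0%N)
  | ?h :: ?tl => lazymatch h with
    | t => constr:(0%N)
    | _ => let k := lmod_find t tl in constr:(S k)
    end
  end.

Ltac lmod_insert t env :=
  lazymatch env with
  | nil => constr:(t :: nil)
  | ?h :: ?tl => lazymatch h with
    | t => constr:(env)
    | _ => let tl' := lmod_insert t tl in constr:(h :: tl')
    end
  end.

Ltac lmod_env t env :=
  lazymatch t with
  | @GRing.add _ ?a ?b => let env1 := lmod_env a env in lmod_env b env1
  | @GRing.opp _ ?a => lmod_env a env
  | @GRing.scale _ _ _ ?a => lmod_env a env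
  | @GRing.zero _ => constr:(env)
  | _ => lmod_insert t env
  end.

Ltac lmod_reify K t env :=
  lazymatch t with
  | @GRing.add _ ?a ?b => let a' := lmod_reify K a env in
      let b' := lmod_reify K b env in constr:(@LAdd K a' b')
  | @GRing.opp _ ?a => let a' := lmod_reify K a env in constr:(@LOpp K a')
  | @GRing.scale _ _ ?r ?a => let a' := lmod_reify K a env in constr:(@LScale K r a')
  | @GRing.zero _ => constr:(@LZero K)
  | _ => let k := lmod_find t env in constr:(@LVar K k)
  end.

Ltac lmod_norm K :=
  lazymatch goal with
  | |- @eq ?M ?a ?b =>
    let env0 := constr:(@nil M) in
    let env1 := lmod_env a env0 in
    let env := lmod_env b env1 in
    let ea := lmod_reify K a env in
    let eb := lmod_reify K b env in
    refine (@lmod_reflection K _ env ea eb _); cbn [lall lcoef size Nat.eqb]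
  end.
Ltac lmod K := lmod_norm K; repeat split; first [ring | field | idtac].

(** * Directional derivatives *)

Section Directional.
Variable R : realType.
Implicit Types V W Z : normedModType R.

(** Clearing the denominator replaces the punctured neighbourhood by a full one, since at [t = 0]
    both sides vanish. *)
Lemma is_derive_normP V W (f : V -> W) (x v : V) (l : W) :
  is_derive x v f l <->
  forall e : R, 0 < e ->
    \forall t \near (0 : R), `|f (x + t *: v) - f x - t *: l| <= e * `|t|.
Proof.
have cvE (k : W) : ((fun h : R => h^-1 *: (f (h *: v + x) - f x)) @ 0^' --> k) <->
  forall e : R, 0 < e ->
    \forall t \near (0 : R), `|f (x + t *: v) - f x - t *: k| <= e * `|t|.
  split=> [/cvgrPdist_le h e e0|h].
    have := h e e0; rewrite near_withinE; apply: filter_app; near=> t => /=.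
    have [->|t0] := eqVneq t 0; first by rewrite !scale0r addr0 subrr subr0 !normr0 mulr0.
    move=> /(_ isT); rewrite (addrC (t *: v)).
    rewrite -(ler_pM2l (_ : 0 < `|t|)) ?normr_gt0// -normrZ scalerBr scalerA divff//.
    by rewrite scale1r -normrN opprB mulrC.
  apply/cvgrPdist_le => e e0; rewrite near_withinE.
  have := h e e0; apply: filter_app; near=> t => /= + t0.
  rewrite -(ler_pM2l (_ : 0 < `|t^-1|)) ?normr_gt0 ?invr_eq0// -normrZ scalerBr.
  rewrite scalerA mulVf// scale1r mulrCA -normrM mulVf// normr1 mulr1.
  by rewrite (addrC (t *: v)) -[in X in X -> _]normrN opprB.
split=> [[dv <-]|/((cvE _).2) h]; first by apply: (cvE _).1; exact: dv.
by apply: DeriveDef; [apply/cvg_ex; exists l|exact: cvg_lim].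
Unshelve. all: by end_near. Qed.

Lemma is_derive_shiftP V W (f : V -> W) (x v : V) (t : R) (l : W) :
  is_derive (x + t *: v) v f l <-> is_derive t 1 (fun s : R => f (x + s *: v)) l.
Proof.
rewrite !is_derive_normP; split=> h e /(h e); apply: filter_app; near=> s.
  by rewrite /= [s *: 1]mulr1 scalerDl addrA.
by rewrite /= [s *: 1]mulr1 scalerDl addrA.
Unshelve. all: by end_near. Qed.

Lemma derivable_continuous1 W (g : R -> W) t : derivable g t 1 -> {for t, continuous g}.
Proof. by move=> /derivable1_diffP/differentiable_continuous. Qed.

(* Real induction: the set of good end points is closed, and open to the right
   because the derivative at its supremum gives the estimate slightly beyond. *)
Lemma mean_value_ineq W (g : R -> W) (c : W) (M : R) :
  (forall t : R, 0 <= t <= 1 -> derivable g t 1) ->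
  (forall t : R, 0 <= t <= 1 -> `|'D_1 g t - c| <= M) ->
  `|g 1 - g 0 - c| <= M.
Proof.
move=> dg hM; apply/ler_addgt0Pr => e e0.
pose A := [set t : R | 0 <= t <= 1 /\
  forall s, 0 <= s <= t -> `|g s - g 0 - s *: c| <= (M + e) * s].
have A0 : A 0.
  split; first by rewrite lexx ler01.
  move=> s; rewrite -eq_le => /eqP <-.
  by rewrite subrr scale0r subr0 normr0 mulr0.
have supA : has_sup A by split; [exists 0|exists 1 => t [/andP[]]].
set T := sup A.
have T01 : 0 <= T <= 1.
  apply/andP; split; first exact: sup_upper_bound.
  by apply: ge_sup; [exists 0|move=> t [/andP[]]].
have ltT s : 0 <= s -> s < T -> `|g s - g 0 - s *: c| <= (M + e) * s.
  move=> s0 /(sup_gt _) []; first by exists 0.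
  by move=> t [_ At] st; apply: At; rewrite s0 ltW.
have /is_derive_normP/(_ _ e0) := derivableP (dg T T01).
move=> [d /= d0 hd].
have step s : `|T - s| < d -> `|g s - g T - (s - T) *: c| <= (M + e) * `|s - T|.
  move=> sd; have : ball_ Num.norm 0 d (s - T) by rewrite /= sub0r opprB.
  move=> /hd; rewrite [(s - T) *: 1]mulr1 addrCA subrr addr0 => h.
  have -> : g s - g T - (s - T) *: c =
     (g s - g T - (s - T) *: 'D_1 g T) + (s - T) *: ('D_1 g T - c).
    by rewrite scalerBr addrA subrK.
  apply: (le_trans (ler_normD _ _)); rewrite normrZ mulrDl addrC lerD//.
  by rewrite mulrC ler_wpM2r//; exact: hM.
have AT : `|g T - g 0 - T *: c| <= (M + e) * T.
  have [T0|Tn0] := eqVneq T 0; first by rewrite T0 subrr scale0r subr0 normr0 mulr0.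
  have Tp : 0 < T by rewrite lt_neqAle eq_sym Tn0; case/andP: T01.
  pose s := Num.max (T / 2) (T - d / 2).
  have s0 : 0 <= s by rewrite le_max; apply/orP; left; rewrite divr_ge0 ?(ltW Tp).
  have sT : s < T.
    by rewrite gt_max ltrBlDr ltrDl divr_gt0// andbT ltr_pdivrMr// mulr_natr mulr2n ltrDl.
  have sd : `|T - s| < d.
    rewrite ger0_norm ?subr_ge0 ?(ltW sT)// ltrBlDr -ltrBlDl.
    by rewrite lt_max; apply/orP; right; rewrite ltrD2l ltrN2 ltr_pdivrMr// mulr_natr mulr2n ltrDl.
  have := ltT s s0 sT; have := step _ sd => h1 h2.
  have -> : g T - g 0 - T *: c = (g s - g 0 - s *: c) - (g s - g T - (s - T) *: c) by lmod R.
  apply: (le_trans (ler_normB _ _)).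
  rewrite [leRHS](_ : _ = (M + e) * s + (M + e) * `|s - T|); first exact: lerD.
  by rewrite -mulrDr distrC ger0_norm ?subr_ge0 ?(ltW sT)// addrCA subrr addr0.
have [T1|Tn1] := eqVneq T 1.
  by move: AT; rewrite T1 scale1r mulr1.
have Tl : T < 1 by rewrite lt_neqAle Tn1; case/andP: T01.
pose s := Num.min 1 (T + d / 2).
have Ts : T < s by rewrite lt_min Tl ltrDl divr_gt0.
suff : A s by move=> As; have := sup_upper_bound supA As; rewrite leNgt Ts.
split.
  by rewrite (le_trans _ (ltW Ts)) ?ge_min ?lexx//; case/andP: T01.
move=> r /andP[r0 rs]; have [rT|Tr] := ltP r T; first exact: ltT.
have rd : `|T - r| < d.
  rewrite distrC ger0_norm ?subr_ge0// ltrBlDl (le_lt_trans rs)// gt_min.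
  by apply/orP; right; rewrite ltrD2l ltr_pdivrMr// mulr_natr mulr2n ltrDl.
have -> : g r - g 0 - r *: c = (g r - g T - (r - T) *: c) + (g T - g 0 - T *: c) by lmod R.
apply: (le_trans (ler_normD _ _)).
rewrite [leRHS](_ : _ = (M + e) * `|r - T| + (M + e) * T); first exact/lerD/AT/step.
by rewrite -mulrDr ger0_norm ?subr_ge0// subrK.
Unshelve. all: by end_near. Qed.
Lemma near_normP V (x : V) (P : V -> Prop) :
  (\forall y \near x, P y) <-> exists2 d : R, 0 < d & forall y, `|y - x| < d -> P y.
Proof.
split=> [/nbhs_normP[d /= d0 hd]|[d d0 hd]].
  by exists d => // y; rewrite distrC; exact: hd.
by apply/nbhs_normP; exists d => // y /=; rewrite distrC; exact: hd.
Qed.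

Lemma continuous_normP V W (f : V -> W) (x : V) :
  {for x, continuous f} <-> forall e : R, 0 < e ->
    exists2 d : R, 0 < d & forall y, `|y - x| < d -> `|f y - f x| < e.
Proof.
split=> [/cvgrPdistC_lt h e /h /near_normP//|h].
by apply/cvgrPdistC_lt => e /h h'; apply/near_normP.
Qed.

Lemma open_normP V (U : set V) :
  open U <-> forall x, U x -> exists2 d : R, 0 < d & forall y, `|y - x| < d -> U y.
Proof.
rewrite openE; split=> h x Ux; first exact/near_normP/h.
exact/near_normP/h.
Qed.

Lemma open_near V (U : set V) (x : V) : open U -> U x -> \forall y \near x, U y.
Proof. by move=> oU Ux; apply: open_nbhs_nbhs. Qed.

Lemma prod_norm_lt V W (z : V * W) (d : R) : (`|z| < d) = (`|z.1| < d) && (`|z.2| < d).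
Proof. by rewrite prod_normE gt_max. Qed.

Lemma prod_norm_le V W (z : V * W) (d : R) : (`|z| <= d) = (`|z.1| <= d) && (`|z.2| <= d).
Proof. by rewrite prod_normE ge_max. Qed.

Lemma openXT V W (U : set V) : open U -> open (U `*` [set: W]).
Proof.
move=> /open_normP oU; apply/open_normP => -[x w] [/= /oU[d d0 hd] _].
by exists d => // -[y v]; rewrite prod_norm_lt => /andP[/= /hd].
Qed.

Lemma openX V W (U : set V) (U' : set W) : open U -> open U' -> open (U `*` U').
Proof.
move=> /open_normP oU /open_normP oU'; apply/open_normP => -[x w].
move=> [/= /oU[d d0 hd] /oU'[d' d'0 hd']].
exists (Num.min d d'); first by rewrite lt_min d0.
move=> -[y v]; rewrite prod_norm_lt /= !lt_min => /andP[/andP[/hd ? _] /andP[_ /hd']].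
by split.
Qed.

Lemma is_derive_dirZ V W (f : V -> W) (x v : V) (l : W) (a : R) :
  is_derive x v f l -> is_derive x (a *: v) f (a *: l).
Proof.
have [->|a0] := eqVneq a 0; first by rewrite !scale0r => _; exact: is_derive0.
move=> /is_derive_normP h; apply/is_derive_normP => e e0.
have ap : 0 < `|a| by rewrite normr_gt0.
have ea : 0 < e / `|a| by rewrite divr_gt0.
have /near_normP[d d0 hd] := h _ ea; apply/near_normP.
exists (d / `|a|); first by rewrite divr_gt0.
move=> t; rewrite subr0 ltr_pdivlMr// -normrM => td.
have := hd (t * a); rewrite subr0 => /(_ td).
by rewrite !scalerA normrM mulrA mulrAC divfK// normr_eq0.
Qed.

Lemma derive_dirZ V W (f : V -> W) (x v : V) (a : R) :
  derivable f x v -> 'D_(a *: v) f x = a *: 'D_v f x.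
Proof. by move=> /derivableP/(is_derive_dirZ a)[]. Qed.

(** The constant [c] is meant to be the value of a linear approximation; the inequality then bounds
    the error of that approximation. *)
Lemma mean_value_ineq_dir V W (f : V -> W) (x v : V) (c : W) (M : R) :
  (forall t : R, 0 <= t <= 1 -> derivable f (x + t *: v) v) ->
  (forall t : R, 0 <= t <= 1 -> `|'D_v f (x + t *: v) - c| <= M) ->
  `|f (x + v) - f x - c| <= M.
Proof.
move=> df hM.
have dg (t : R) : 0 <= t <= 1 ->
    is_derive t 1 (fun s : R => f (x + s *: v)) ('D_v f (x + t *: v)).
  by move=> /df /derivableP h; exact: (is_derive_shiftP f x v t _).1 h.
have := @mean_value_ineq _ (fun s : R => f (x + s *: v)) c M.
rewrite scale1r scale0r addr0; apply=> t t01; first by have [] := dg _ t01.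
by have [_ ->] := dg _ t01; exact: hM.
Qed.

(** The increment along [u + v] is one along [v], controlled at [x] itself, followed by one along
    [u] from a moving point, controlled by the mean value inequality. Continuity is asked along [u]
    alone, so that sums of directions can be built up one summand at a time. *)
Lemma is_derive_dirD V W (f : V -> W) (x u v : V) (l m : W) :
  (\forall y \near x, derivable f y u) -> {for x, continuous (fun y => 'D_u f y)} ->
  'D_u f x = l -> is_derive x v f m -> is_derive x (u + v) f (l + m).
Proof.
move=> /near_normP[d1 d10 du] /continuous_normP cu ul /is_derive_normP hv.
apply/is_derive_normP => e e0.
have e20 : 0 < e / 2 by rewrite divr_gt0.
have [d2 d20 hd2] := cu _ e20; have /near_normP[d3 d30 hd3] := hv _ e20.
pose K := `|u| + `|v| + 1.
have K0 : 0 < K by rewrite /K ltr_wpDl.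
apply/near_normP; exists (Num.min d3 (Num.min d1 d2 / K)).
  by rewrite lt_min d30 divr_gt0// lt_min d10.
move=> t; rewrite subr0 lt_min ltr_pdivlMr// => /andP[td3 tK].
have := hd3 t; rewrite subr0 => /(_ td3) h.
have -> : f (x + t *: (u + v)) - f x - t *: (l + m) =
   (f (x + t *: v + t *: u) - f (x + t *: v) - t *: l) + (f (x + t *: v) - f x - t *: m).
  rewrite (_ : x + t *: (u + v) = x + t *: v + t *: u); last by lmod R.
  by lmod R.
rewrite (le_trans (ler_normD _ _))// (splitr e) mulrDl lerD//.
have near_s (s : R) : 0 <= s <= 1 -> `|x + t *: v + s *: (t *: u) - x| < Num.min d1 d2.
  move=> /andP[s0 s1]; apply: le_lt_trans tK.
  rewrite (_ : _ - x = t *: (v + s *: u)); last by lmod R.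
  rewrite normrZ ler_wpM2l// (le_trans (ler_normD _ _))// normrZ ger0_norm//.
  have : s * `|u| <= `|u| by rewrite ler_piMl.
  by rewrite /K; lra.
apply: mean_value_ineq_dir => s /near_s; rewrite lt_min => /andP[s1 s2].
  have /derivableP/(is_derive_dirZ t)[] := du _ s1; by [].
rewrite derive_dirZ; last exact: du.
rewrite -scalerBr normrZ mulrC ler_wpM2r// ltW//.
by have := hd2 _ s2; rewrite ul.
Qed.

(** The difference quotient [u] of [f] is itself used as a direction for [g]. Joint continuity of
    the derivative in point and direction then compares ['D_u g] near [f x] with ['D_w g (f x)]. *)
Lemma is_derive_comp V W Z (f : V -> W) (g : W -> Z) (x v : V) (w : W) :
  is_derive x v f w ->
  (\forall y \near f x, forall u, derivable g y u) ->
  {for (f x, w), continuous (fun z : W * W => 'D_(z.2) g z.1)} ->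
  is_derive x v (fun t => g (f t)) ('D_w g (f x)).
Proof.
move=> /is_derive_normP df /near_normP[d1 d10 dg] /continuous_normP cg.
apply/is_derive_normP => e e0.
have [d2 d20 hd2] := cg _ e0.
(* The bound [1] keeps the quotient [u] below [K]; the bound [d2 / 2] keeps it within reach of
   [hd2]. *)
have e1 : 0 < Num.min 1 (d2 / 2) by rewrite lt_min ltr01 divr_gt0.
have /near_normP[d3 d30 hd3] := df _ e1.
pose K := `|w| + 1; have K0 : 0 < K by rewrite /K ltr_wpDl.
apply/near_normP; exists (Num.min d3 (Num.min d1 d2 / K)).
  by rewrite lt_min d30 divr_gt0// lt_min d10.
move=> t; rewrite subr0 lt_min ltr_pdivlMr// => /andP[td3 tK].
have [->|t0] := eqVneq t 0; first by rewrite !scale0r addr0 subrr subr0 !normr0 mulr0.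
have := hd3 t; rewrite subr0 => /(_ td3) h.
pose u := t^-1 *: (f (x + t *: v) - f x).
have fu : f (x + t *: v) = f x + t *: u by rewrite /u; lmod R.
have tp : 0 < `|t| by rewrite normr_gt0.
have uw : `|u - w| <= Num.min 1 (d2 / 2).
  move: h; rewrite fu (_ : _ - f x - _ = t *: (u - w)); last by lmod R.
  by rewrite normrZ mulrC ler_pM2r.
have uK : `|u| <= K.
  rewrite (_ : u = w + (u - w)); last by lmod R.
  by rewrite (le_trans (ler_normD _ _))// lerD2l (le_trans uw)// ge_min lexx.
have near_s (s : R) : 0 <= s <= 1 -> `|f x + s *: (t *: u) - f x| < Num.min d1 d2.
  move=> /andP[s0 s1]; apply: le_lt_trans tK.
  rewrite (_ : _ - f x = t *: (s *: u)); last by lmod R.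
  by rewrite normrZ ler_wpM2l// normrZ ger0_norm// (le_trans _ uK)// ler_piMl.
rewrite fu; apply: mean_value_ineq_dir => s /near_s; rewrite lt_min => /andP[s1 s2].
  by apply: dg.
rewrite derive_dirZ; last exact: dg.
rewrite -scalerBr normrZ mulrC ler_wpM2r// ltW//.
have := hd2 (f x + s *: (t *: u), u); apply; rewrite prod_norm_lt /= s2 /=.
rewrite (le_lt_trans uw)// gt_min; apply/orP; right.
by rewrite ltr_pdivrMr// mulr_natr mulr2n ltrDl.
Qed.

Lemma is_derive_pair V W Z (f : V -> W) (g : V -> Z) (x v : V) l m :
  is_derive x v f l -> is_derive x v g m ->
  is_derive x v (fun t => (f t, g t)) (l, m).
Proof.
move=> /is_derive_normP hf /is_derive_normP hg; apply/is_derive_normP => e e0.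
near=> t; rewrite prod_norm_le /=; apply/andP; split; near: t; [exact: hf|exact: hg].
Unshelve. all: by end_near. Qed.

Lemma continuous_pair V W Z (f : V -> W) (g : V -> Z) x :
  {for x, continuous f} -> {for x, continuous g} ->
  {for x, continuous (fun t => (f t, g t))}.
Proof. by move=> cf cg; apply: cvg_pair. Qed.

Lemma continuous_cst_at V W (w : W) (x : V) : {for x, continuous (fun=> w)}.
Proof. exact: cvg_cst. Qed.

Lemma continuous_id_at V (x : V) : {for x, continuous (fun y : V => y)}.
Proof. exact: cvg_id. Qed.

End Directional.

(** * Michal-Bastiani differentiability *)

Section MB.
Variable R : realType.
Implicit Types V W Z : normedModType R.

(* Unlike [Ck_on], this class treats the base point and the direction as one joint
   argument, so that the chain rule and the induction on the order need no bases. *)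
Fixpoint MB (k : nat) V W (U : set V) (f : V -> W) : Prop :=
  match k with
  | O => forall x, U x -> {for x, continuous f}
  | S k' => (forall x, U x -> {for x, continuous f}) /\
            (forall x v, U x -> derivable f x v) /\
            MB k' (U `*` [set: V]) (fun z : V * V => 'D_(z.2) f z.1)
  end.

Lemma MB_continuous k V W (U : set V) (f : V -> W) x :
  MB k U f -> U x -> {for x, continuous f}.
Proof. by case: k => [|k] h Ux; [exact: h|exact: h.1]. Qed.

Lemma MB_derivable k V W (U : set V) (f : V -> W) x v :
  MB k.+1 U f -> U x -> derivable f x v.
Proof. by move=> [_ [h _]] Ux; exact: h. Qed.

Lemma MB_derive k V W (U : set V) (f : V -> W) :
  MB k.+1 U f -> MB k (U `*` [set: V]) (fun z : V * V => 'D_(z.2) f z.1).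
Proof. by case=> _ []. Qed.

Lemma MB_derive_continuous k V W (U : set V) (f : V -> W) x v :
  MB k.+1 U f -> U x -> {for (x, v), continuous (fun z : V * V => 'D_(z.2) f z.1)}.
Proof. by move=> /MB_derive h Ux; exact: MB_continuous h _. Qed.

Lemma MB_S k V W (U : set V) (f : V -> W) : MB k.+1 U f -> MB k U f.
Proof.
elim: k V U f => [|k IH] V U f [cf [df hf]]; first exact: cf.
by split=> //; split=> //; exact: IH.
Qed.

Lemma MB_eq k V W (U : set V) (f g : V -> W) :
  open U -> (forall x, U x -> f x = g x) -> MB k U f -> MB k U g.
Proof.
elim: k V U f g => [|k IH] V U f g oU fg.
  move=> /= h x Ux.
  have nfg : \forall y \near x, f y = g y by apply: filterS (open_near oU Ux).
  rewrite /prop_for /continuous_at -(fg _ Ux).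
  by apply: cvg_trans (h x Ux); exact: near_eq_cvg.
have near_fg x : U x -> \forall y \near x, f y = g y.
  by move=> Ux; apply: filterS (open_near oU Ux).
move=> [cf [df hf]]; split.
  move=> x Ux; rewrite /prop_for /continuous_at -(fg _ Ux).
  by apply: cvg_trans (cf x Ux); apply: near_eq_cvg; exact: near_fg.
split; first by move=> x v Ux; apply: near_eq_derivable (near_fg _ Ux) _; exact: df.
apply: IH hf; first exact: openXT.
by move=> z [Uz _]; apply: near_eq_derive; exact: near_fg.
Qed.

(** [MB] is a conjunction of conditions at the points of the set, so each point may bring its own
    set. *)
Lemma MB_glue k V W (U : set V) (f : V -> W) :
  (forall x, U x -> exists2 U' : set V, U' x & MB k U' f) -> MB k U f.
Proof.
elim: k V U f => [|k IH] V U f h.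
  by move=> x /h[U' U'x hU']; exact: hU'.
split; first by move=> x /h[U' U'x [cU' _]]; exact: cU'.
split; first by move=> x v /h[U' U'x [_ [dU' _]]]; exact: dU'.
apply: IH => -[x v] [/= /h[U' U'x [_ [_ hU']]] _].
by exists (U' `*` setT).
Qed.

Lemma MB_cst k V W (U : set V) (w : W) : MB k U (fun=> w).
Proof.
elim: k V W U w => [|k IH] V W U w /=; first by move=> x _; exact: cvg_cst.
split; first by move=> x _; exact: cvg_cst.
split; first by move=> x v _; exact: derivable_cst.
rewrite (_ : (fun z : V * V => _) = fun=> 0); first exact: IH.
by apply/funext => z; rewrite derive_cst.
Qed.

Definition continuous_linear V W (L : V -> W) :=
  (forall (a : R) u v, L (a *: u + v) = a *: L u + L v) /\ continuous L.

Lemma is_derive_continuous_linear V W (L : V -> W) (x v : V) :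
  continuous_linear L -> is_derive x v L (L v).
Proof.
move=> [lL _]; apply/is_derive_normP => e e0; near=> t.
rewrite [x + _]addrC lL (_ : _ - _ = 0); last by lmod R.
by rewrite normr0 mulr_ge0// ltW.
Unshelve. all: by end_near. Qed.

(** The joint derivative sends [(x, v)] to [L v], which is again continuous and linear, now on the
    product space. *)
Lemma MB_linear k V W (U : set V) (L : V -> W) : continuous_linear L -> MB k U L.
Proof.
elim: k V U L => [|k IH] V U L lL; have [ll cL] := lL => /=; first by move=> x _; exact: cL.
split; first by move=> x _; exact: cL.
split; first by move=> x v _; have [] := is_derive_continuous_linear x v lL.
rewrite (_ : (fun z : V * V => _) = fun z => L z.2).
  apply: IH; split; first by move=> a u v; exact: ll.
  by move=> z; apply: continuous_comp; [exact: cvg_snd|exact: cL].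
by apply/funext => z; have [] := is_derive_continuous_linear z.1 z.2 lL.
Qed.

Lemma continuous_linear_fst V W : continuous_linear (@fst V W).
Proof. by split=> // z; exact: cvg_fst. Qed.

Lemma continuous_linear_snd V W : continuous_linear (@snd V W).
Proof. by split=> // z; exact: cvg_snd. Qed.

Lemma continuous_linear_add V : continuous_linear (fun z : V * V => z.1 + z.2).
Proof.
split=> [a u v|]; last exact: add_continuous.
case: u v => [u1 u2] [v1 v2]; rewrite /=; lmod R.
Qed.

Lemma continuous_linear_opp V : continuous_linear (fun z : V => - z).
Proof. by split=> [a u v|]; [lmod R|exact: opp_continuous]. Qed.

Lemma MB_pair k V W Z (U : set V) (f : V -> W) (g : V -> Z) : open U ->
  MB k U f -> MB k U g -> MB k U (fun x => (f x, g x)).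
Proof.
elim: k V W Z U f g => [|k IH] V W Z U f g oU.
  by move=> hf hg x Ux; apply: continuous_pair; [exact: hf|exact: hg].
move=> hf hg; split.
  move=> x Ux; apply: continuous_pair; [exact: MB_continuous hf _|exact: MB_continuous hg _].
have dfg x v : U x -> is_derive x v (fun x => (f x, g x)) ('D_v f x, 'D_v g x).
  by move=> Ux; apply: is_derive_pair; apply: derivableP;
    [exact: MB_derivable hf _|exact: MB_derivable hg _].
split; first by move=> x v /(dfg _ v)[].
apply: MB_eq (IH _ _ _ _ _ _ (openXT oU) (MB_derive hf) (MB_derive hg)).
  exact: openXT.
by move=> -[x v] [/= /(dfg _ v)[_ ->]].
Qed.

(** The joint derivative of the composite is the joint derivative of [g] after
    [(x, v) -> (f x, 'D_v f x)]. Both factors have order [k], so the induction closes without higher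
    order chain rules. *)
Lemma MB_comp k V W Z (U : set V) (U' : set W) (f : V -> W) (g : W -> Z) :
  open U -> open U' -> (forall x, U x -> U' (f x)) ->
  MB k U f -> MB k U' g -> MB k U (fun x => g (f x)).
Proof.
elim: k V W Z U U' f g => [|k IH] V W Z U U' f g oU oU' UU'.
  move=> hf hg x Ux; apply: continuous_comp; first exact: hf.
  by apply: hg; exact: UU'.
move=> hf hg; split.
  move=> x Ux; apply: continuous_comp; first exact: MB_continuous hf _.
  by apply: MB_continuous hg _; exact: UU'.
have dfg x v : U x -> is_derive x v (fun t => g (f t)) ('D_('D_v f x) g (f x)).
  move=> Ux; apply: is_derive_comp.
  - by apply: derivableP; exact: MB_derivable hf _.
  - apply: filterS (open_near oU' (UU' _ Ux)) => y U'y u.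
    exact: MB_derivable hg _.
  - by apply: MB_derive_continuous hg _; exact: UU'.
split; first by move=> x v /(dfg _ v)[].
have oUT : open (U `*` [set: V]) by exact: openXT.
have oUT' : open (U' `*` [set: W]) by exact: openXT.
have h : MB k (U `*` [set: V]) (fun z : V * V => (f z.1, 'D_(z.2) f z.1)).
  apply: MB_pair => //; last exact: MB_derive.
  apply: (IH _ _ _ _ U fst) => //; first by move=> z [].
    by apply: MB_linear; exact: continuous_linear_fst.
  exact: MB_S.
apply: (MB_eq oUT); last first.
  by apply: (IH _ _ _ _ (U' `*` [set: W]) _ _ oUT oUT' _ h (MB_derive hg)) => z [/UU'].
by move=> -[x v] [/= /(dfg _ v)[_ ->]].
Qed.

Lemma MB_compT k V W Z (U : set V) (f : V -> W) (g : W -> Z) :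
  open U -> MB k U f -> MB k [set: W] g -> MB k U (fun x => g (f x)).
Proof. by move=> oU; apply: MB_comp => //; exact: openT. Qed.

Section Closure.
Variables (k : nat) (V : normedModType R) (U : set V).
Hypothesis oU : open U.

Lemma MB_fst W Z (f : V -> W * Z) : MB k U f -> MB k U (fun x => (f x).1).
Proof. by move=> h; apply: (MB_compT oU h); apply: MB_linear; exact: continuous_linear_fst. Qed.

Lemma MB_snd W Z (f : V -> W * Z) : MB k U f -> MB k U (fun x => (f x).2).
Proof. by move=> h; apply: (MB_compT oU h); apply: MB_linear; exact: continuous_linear_snd. Qed.

Lemma MB_id : MB k U (fun x => x).
Proof. by apply: MB_linear; split=> // x; exact: cvg_id. Qed.

Lemma MB_add W (f g : V -> W) : MB k U f -> MB k U g -> MB k U (fun x => f x + g x).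
Proof.
move=> hf hg.
exact: (MB_compT oU (MB_pair oU hf hg) (MB_linear k _ (continuous_linear_add W))).
Qed.

Lemma MB_opp W (f : V -> W) : MB k U f -> MB k U (fun x => - f x).
Proof.
by move=> hf; exact: (MB_compT oU hf (MB_linear k _ (continuous_linear_opp W))).
Qed.

Lemma MB_sub W (f g : V -> W) : MB k U f -> MB k U g -> MB k U (fun x => f x - g x).
Proof. by move=> hf hg; apply: MB_add => //; exact: MB_opp. Qed.

End Closure.

Lemma is_derive_scale W (z v : R * W) :
  is_derive z v (fun z : R * W => z.1 *: z.2) (z.1 *: v.2 + v.1 *: z.2).
Proof.
apply/is_derive_normP => e e0; apply/near_normP.
pose K := `|v.1 *: v.2| + 1; have K0 : 0 < K by rewrite ltr_wpDl.
exists (e / K); first by rewrite divr_gt0.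
move=> t; rewrite subr0 ltr_pdivlMr// => tK.
rewrite (_ : _ - _ - _ = t *: (t *: (v.1 *: v.2))); last first.
  rewrite -[(z + t *: v).1]/(z.1 + t * v.1) -[(z + t *: v).2]/(z.2 + t *: v.2).
  by rewrite scalerDl !scalerDr; lmod R.
rewrite normrZ mulrC ler_wpM2r// normrZ (le_trans _ (ltW tK))// ler_wpM2l//.
by rewrite /K lerDl.
Qed.

(** The derivative of the bilinear map is a sum of two instances of the same map composed with
    projections. *)
Lemma MB_scale0 k W : MB k [set: R * W] (fun z : R * W => z.1 *: z.2).
Proof.
elim: k => [|k IH]; first by move=> z _; exact: scale_continuous.
split; first by move=> z _; exact: scale_continuous.
split; first by move=> z v _; have [] := is_derive_scale z v.
have oT : open ([set: R * W] `*` [set: R * W]) by apply: openXT; exact: openT.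
have h1 : MB k ([set: R * W] `*` [set: R * W]) fst.
  by apply: MB_linear; exact: continuous_linear_fst.
have h2 : MB k ([set: R * W] `*` [set: R * W]) snd.
  by apply: MB_linear; exact: continuous_linear_snd.
rewrite (_ : (fun z => _) = fun z : (R * W) * (R * W) => z.1.1 *: z.2.2 + z.2.1 *: z.1.2).
  apply: MB_add => //.
    apply: (MB_compT oT (_ : MB k _ (fun z : (R * W) * (R * W) => (z.1.1, z.2.2))) IH).
    by apply: MB_pair => //; [exact: MB_fst|exact: MB_snd].
  apply: (MB_compT oT (_ : MB k _ (fun z : (R * W) * (R * W) => (z.2.1, z.1.2))) IH).
  by apply: MB_pair => //; [exact: MB_fst|exact: MB_snd].
by apply/funext => z; have [] := is_derive_scale z.1 z.2.
Qed.

Lemma MB_scale k V W (U : set V) (r : V -> R) (f : V -> W) : open U ->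
  MB k U r -> MB k U f -> MB k U (fun x => r x *: f x).
Proof. by move=> oU hr hf; exact: (MB_compT oU (MB_pair oU hr hf) (MB_scale0 k W)). Qed.

Lemma open_neq0 : open [set r : R | r != 0].
Proof.
apply/open_normP => x /= x0; exists `|x|; first by rewrite normr_gt0.
by move=> y; apply: contraTneq => ->; rewrite sub0r normrN ltxx.
Qed.

Lemma is_derive_inv (r v : R) : r != 0 -> is_derive r v (fun s : R => s^-1) (- (r^-1 * r^-1) *: v).
Proof.
move=> r0.
have := @is_deriveV R id r v v r0 (is_derive_id r v).
by rewrite -expr2 exprVn.
Qed.

(** The derivative is a product of inverses and the direction, so its regularity follows from that
    of the inverse one order lower. *)
Lemma MB_inv0 k : MB k [set r : R | r != 0] (fun r : R => r^-1).
Proof.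
have oN := open_neq0.
elim: k => [|k IH]; first by move=> r r0; exact: inv_continuous.
split; first by move=> r r0; exact: inv_continuous.
split; first by move=> r v r0; have [] := is_derive_inv v r0.
have oT : open ([set r : R | r != 0] `*` [set: R]) by exact: openXT.
have h1 : MB k ([set r : R | r != 0] `*` [set: R]) fst.
  by apply: MB_linear; exact: continuous_linear_fst.
have h2 : MB k ([set r : R | r != 0] `*` [set: R]) snd.
  by apply: MB_linear; exact: continuous_linear_snd.
have hV : MB k ([set r : R | r != 0] `*` [set: R]) (fun z : R * R => z.1^-1).
  by apply: (MB_comp oT oN _ h1 IH) => z [].
apply: (MB_eq oT (f := fun z : R * R => (- (z.1^-1 *: z.1^-1) : R) *: z.2)).
  by move=> z [/= z0 _]; have [_ ->] := is_derive_inv z.2 z0.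
apply: (MB_scale oT _ h2); apply: MB_opp => //; exact: MB_scale.
Qed.

Lemma MB_inv k V (U : set V) (r : V -> R) : open U -> (forall x, U x -> r x != 0) ->
  MB k U r -> MB k U (fun x => (r x)^-1).
Proof. by move=> oU r0 hr; exact: (MB_comp oU open_neq0 r0 hr (MB_inv0 k)). Qed.

Lemma derive_dirD V W (U : set V) (f : V -> W) (x u v : V) :
  open U -> MB 1 U f -> U x -> 'D_(u + v) f x = 'D_u f x + 'D_v f x.
Proof.
move=> oU hf Ux; have [] // := @is_derive_dirD _ _ _ f x u v ('D_u f x) ('D_v f x).
- by apply: filterS (open_near oU Ux) => y Uy; exact: MB_derivable hf _.
- apply: (@continuous_comp _ _ _ (fun y => (y, u)) (fun z : V * V => 'D_(z.2) f z.1)).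
    by apply: continuous_pair; [exact: cvg_id|exact: cvg_cst].
  exact: MB_derive_continuous hf _.
- by apply: derivableP; exact: MB_derivable hf _.
Qed.

End MB.

(** * Finite dimension: coordinates, compact unit balls and uniform estimates *)

Section FiniteDimension.
Variable R : realType.
Implicit Types V W Z : normedModType R.

(** A finite spanning family with continuous coordinate functionals recovers the derivative in any
    direction from finitely many fixed directions. *)
Definition has_coordinates V := exists (I : finType) (e : I -> V) (l : I -> V -> R),
  (forall i, continuous_linear (l i)) /\ forall v, v = \sum_i l i v *: e i.

Lemma has_coordinates_R : has_coordinates R.
Proof.
exists 'I_1, (fun=> 1), (fun=> id); split.
  by move=> i; split=> // x A /=; rewrite nbhs_simpl.
by move=> v; rewrite big_ord1 [_ *: _]mulr1.
Qed.

Lemma has_coordinates_rV n : has_coordinates 'rV[R]_n.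
Proof.
exists 'I_n, (fun i => delta_mx 0 i), (fun i (v : 'rV[R]_n) => v 0 i); split.
  by move=> i; split=> [a u v|]; [rewrite !mxE|exact: coord_continuous].
by move=> v; exact: row_sum_delta.
Qed.

Lemma has_coordinates_prod V W :
  has_coordinates V -> has_coordinates W -> has_coordinates (V * W)%type.
Proof.
move=> [I [e [l [hl hv]]]] [J [e' [l' [hl' hw]]]].
exists (I + J)%type.
exists (fun k => match k with inl i => (e i, 0) | inr j => (0, e' j) end).
exists (fun k z => match k with inl i => l i z.1 | inr j => l' j z.2 end); split.
  move=> [i|j]; split.
  - by move=> a u v; have [-> _] := hl i.
  - by move=> z; apply: continuous_comp; [exact: cvg_fst|exact: (hl i).2].
  - by move=> a u v; have [-> _] := hl' j.
  - by move=> z; apply: continuous_comp; [exact: cvg_snd|exact: (hl' j).2].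
move=> [v w]; rewrite big_sumType /=.
rewrite (_ : \sum_i _ = (v, 0)); last first.
  rewrite [in RHS](hv v); apply/eqP; rewrite -pair_eqE /= !(raddf_sum fst) !(raddf_sum snd) /=.
  by apply/andP; split; [|rewrite big1// => i _; rewrite scaler0].
rewrite (_ : \sum_j _ = (0, w)); last first.
  rewrite [in RHS](hw w); apply/eqP; rewrite -pair_eqE /= !(raddf_sum fst) !(raddf_sum snd) /=.
  by apply/andP; split; [rewrite big1// => i _; rewrite scaler0|].
by rewrite -[_ + _]/(v + 0, 0 + w) addr0 add0r.
Qed.

Lemma MB_sum k V W (U : set V) (I : Type) (r : seq I) (f : I -> V -> W) : open U ->
  (forall i, MB k U (f i)) -> MB k U (fun x => \sum_(i <- r) f i x).
Proof.
move=> oU hf; elim: r => [|i r IH].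
  rewrite (_ : (fun x => _) = fun=> 0); first exact: MB_cst.
  by apply/funext => x; rewrite big_nil.
rewrite (_ : (fun x => _) = fun x => f i x + \sum_(j <- r) f j x); first exact: MB_add.
by apply/funext => x; rewrite big_cons.
Qed.

Lemma is_derive_dir_sum V W (f : V -> W) (x : V) (I : Type) (r : seq I)
    (e : I -> V) (a : I -> R) :
  (\forall y \near x, forall u, derivable f y u) ->
  (forall u, {for x, continuous (fun y => 'D_u f y)}) ->
  is_derive x (\sum_(i <- r) a i *: e i) f (\sum_(i <- r) a i *: 'D_(e i) f x).
Proof.
move=> df cf; elim: r => [|i r IH]; first by rewrite !big_nil; exact: is_derive0.
rewrite !big_cons; apply: is_derive_dirD IH => //.
  by apply: filterS df.
by rewrite derive_dirZ//; exact: (nbhs_singleton df).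
Qed.

(** By linearity ['D_v f x] is the sum of [l i v *: 'D_(e i) f x]. Each summand separates the
    direction from the point, so regularity along the fixed directions [e i] becomes joint
    regularity. *)
Lemma Ck_on_MB k V W (U : set V) (f : V -> W) : has_coordinates V -> open U ->
  Ck_on U k f -> MB k U f.
Proof.
move=> hV oU; have [I [e [l [hl hv]]]] := hV; elim: k f => [|k IH] f.
  by move=> h x Ux; apply: h; rewrite inE.
move=> [cf [df hf]]; split; first by move=> x Ux; apply: cf; rewrite inE.
split; first by move=> x v Ux; exact: df.
have oUT : open (U `*` [set: V]) by exact: openXT.
apply: (MB_eq oUT (f := fun z : V * V => \sum_i l i z.2 *: 'D_(e i) f z.1)).
  move=> -[x v] [/= Ux _].
  have [|u|_ <-] := @is_derive_dir_sum _ _ f x _ (index_enum I) e (l^~ v); last by rewrite -hv.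
  - by apply: filterS (open_near oU Ux) => y Uy u; exact: df.
  - by clear IH; case: k hf => [|k] hf; [apply: (hf u)|apply: (hf u).1]; rewrite inE.
apply: MB_sum => // i; apply: MB_scale => //.
  apply: (MB_compT (g := l i) oUT); last exact: MB_linear.
  by apply: MB_linear; exact: continuous_linear_snd.
apply: (MB_comp (f := fst) (g := fun x => 'D_(e i) f x) oUT oU); last exact: IH (hf _).
  by move=> z [].
by apply: MB_linear; exact: continuous_linear_fst.
Qed.

Lemma MB_Ck_on k V W (U : set V) (f : V -> W) : open U -> MB k U f -> Ck_on U k f.
Proof.
move=> oU; elim: k f => [|k IH] f; first by move=> h x /set_mem; exact: h.
move=> [cf [df hf]]; split; first by move=> x /set_mem; exact: cf.
split; first by move=> x Ux v; exact: df.
move=> v; apply: IH.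
have oUT : open (U `*` [set: V]) by exact: openXT.
apply: (MB_comp (f := fun x => (x, v)) oU oUT _ _ hf) => //.
by apply: MB_pair => //; [exact: MB_id|exact: MB_cst].
Qed.

(** The form in which finite dimension enters the estimates that are uniform over directions. *)
Definition compact_unit_ball V := compact [set v : V | `|v| <= 1].

Lemma compact_unit_ball_R : compact_unit_ball R.
Proof.
rewrite /compact_unit_ball (_ : [set v : R | _] = [set` `[-1, 1]%R]); first exact: segment_compact.
by apply/seteqP; split=> x /=; rewrite in_itv /= ler_norml.
Qed.

Lemma compact_ball_rV n (B : R) : compact [set v : 'rV[R]_n | `|v| <= B].
Proof.
apply: bounded_closed_compact.
  exists B; split; first exact: num_real.
  by move=> x Bx v /= vB; rewrite (le_trans vB)// ltW.
apply: (@closed_comp _ _ (fun v : 'rV[R]_n => `|v|) [set x | x <= B]).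
  by move=> x _; exact: norm_continuous.
exact: closed_le.
Qed.

Lemma compact_unit_ball_rV n : compact_unit_ball 'rV[R]_n.
Proof. exact: compact_ball_rV. Qed.

Lemma compact_unit_ball_prod V W :
  compact_unit_ball V -> compact_unit_ball W -> compact_unit_ball (V * W)%type.
Proof.
move=> hV hW; rewrite /compact_unit_ball.
rewrite (_ : [set z | _] = [set v : V | `|v| <= 1] `*` [set w : W | `|w| <= 1]).
  exact: compact_setX.
by apply/seteqP; split=> -[v w] /=; rewrite prod_norm_le => /andP.
Qed.

(** Continuity of the differential in operator norm: joint continuity gives the estimate near each
    unit direction, compactness of the ball makes it uniform, and homogeneity extends it to all
    directions. *)
Lemma derive_uniform V W (U : set V) (f : V -> W) (x : V) (e : R) :
  compact_unit_ball V -> open U -> MB 1 U f -> U x -> 0 < e ->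
  \forall y \near x, U y /\ forall w, `|'D_w f y - 'D_w f x| <= e * `|w|.
Proof.
move=> /compact_near_coveringP cV oU hf Ux e0.
have : \forall y \near x, [set v : V | `|v| <= 1] `<=`
    [set w | U y /\ `|'D_w f y - 'D_w f x| <= e].
  apply: (cV V (nbhs x) (fun y w => U y /\ `|'D_w f y - 'D_w f x| <= e)) => w0 _.
  have e20 : 0 < e / 2 by rewrite divr_gt0.
  have /continuous_normP/(_ _ e20)[d d0 hd] := MB_derive_continuous (v := w0) hf Ux.
  have /near_normP[d' d'0 hd'] := open_near oU Ux.
  exists ([set w | `|w - w0| < d], [set y | `|y - x| < Num.min d d']).
    by split; apply/near_normP; [exists d|exists (Num.min d d'); rewrite ?lt_min ?d0].
  move=> [w y] /= [wd]; rewrite lt_min => /andP[yd yd']; split; first exact: hd'.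
  have h1 := hd (y, w); have h2 := hd (x, w).
  rewrite (_ : _ - _ = ('D_w f y - 'D_w0 f x) - ('D_w f x - 'D_w0 f x)); last by lmod R.
  rewrite (le_trans (ler_normB _ _))// (splitr e) lerD// ltW//.
    by apply: h1; rewrite prod_norm_lt /= yd wd.
  by apply: h2; rewrite prod_norm_lt /= subrr normr0 d0.
apply: filterS => y h; split; first by have [] := h 0; rewrite //= normr0.
move=> w; have [->|w0] := eqVneq w 0; first by rewrite !derive0 subrr !normr0 mulr0.
have wp : 0 < `|w| by rewrite normr_gt0.
have : [set v : V | `|v| <= 1] (`|w|^-1 *: w).
  by rewrite /= normrZ normfV normr_id mulVf// gt_eqF.
move=> /h[Uy].
rewrite (derive_dirZ _ (MB_derivable hf Uy)) (derive_dirZ _ (MB_derivable hf Ux)).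
by rewrite -scalerBr normrZ normfV normr_id ler_pdivrMl// mulrC.
Qed.

(** Strict differentiability: both points vary. The ball around [x] is convex, so the mean value
    inequality applies on the segment between them with the differential at [x] as the constant. *)
Lemma strict_derive V W (U : set V) (f : V -> W) (x : V) (e : R) :
  compact_unit_ball V -> open U -> MB 1 U f -> U x -> 0 < e ->
  exists2 d : R, 0 < d & (forall y, `|y - x| < d -> U y) /\
   forall y y', `|y - x| < d -> `|y' - x| < d ->
    `|f y' - f y - 'D_(y' - y) f x| <= e * `|y' - y|.
Proof.
move=> cV oU hf Ux e0.
have /near_normP[d d0 hd] := derive_uniform cV oU hf Ux e0.
exists d => //; split; first by move=> y /hd[].
move=> y y' yd y'd.
have near_s (s : R) : 0 <= s <= 1 -> `|y + s *: (y' - y) - x| < d.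
  move=> /andP[s0 s1].
  rewrite (_ : _ - x = (1 - s) *: (y - x) + s *: (y' - x)); last by lmod R.
  apply: (le_lt_trans (ler_normD _ _)); rewrite !normrZ !ger0_norm ?subr_ge0//.
  (* The end point is treated apart because the strict inequality below is multiplied by [s]. *)
  have [s00|sn0] := eqVneq s 0; first by rewrite s00 subr0 mul1r mul0r addr0.
  have sp : 0 < s by rewrite lt_neqAle eq_sym sn0.
  have : s * `|y' - x| < s * d by rewrite ltr_pM2l.
  have : (1 - s) * `|y - x| <= (1 - s) * d by rewrite ler_wpM2l ?subr_ge0// ltW.
  lra.
have -> : f y' = f (y + (y' - y)) by congr f; lmod R.
apply: mean_value_ineq_dir => s /near_s/hd[Us hs]; last exact: hs.
exact: MB_derivable hf _.
Qed.

(** The constant is the minimum of the norm of [L] on the unit sphere, which is positive by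
    injectivity. *)
Lemma injective_bounded_below V W (L : V -> W) : compact_unit_ball V ->
  continuous L -> (forall (a : R) v, L (a *: v) = a *: L v) ->
  (forall v, L v = 0 -> v = 0) -> exists2 c : R, 0 < c & forall v, c * `|v| <= `|L v|.
Proof.
move=> cV cL lL iL.
(* In the zero space the sphere is empty and there is no minimum to take. *)
have [[v0 v00]|V0] := pselect (exists v : V, v != 0); last first.
  exists 1 => // v; have [->|v0] := eqVneq v 0; first by rewrite normr0 mulr0.
  by exfalso; apply: V0; exists v.
pose S := [set v : V | `|v| = 1].
have cS : compact S.
  apply: subclosed_compact cV _; last by move=> v /= ->.
  apply: (@closed_comp _ _ (fun v : V => `|v|) [set x | x = 1]).
    by move=> x _; exact: norm_continuous.
  exact: closed_eq.
have S0 : S !=set0.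
  by exists (`|v0|^-1 *: v0); rewrite /S /= normrZ normfV normr_id mulVf// normr_eq0.
have [] := @compact_EVT_min _ _ (fun v => `|L v|) _ S0 cS.
  apply: continuous_subspaceT => v; apply: continuous_comp; first exact: cL.
  exact: norm_continuous.
move=> c /set_mem cS1 hc; exists `|L c|.
  rewrite normr_gt0; apply/eqP => /iL c0.
  by move: cS1; rewrite /S /= c0 normr0 => /eqP; rewrite eq_sym oner_eq0.
move=> v; have [->|vn0] := eqVneq v 0; first by rewrite normr0 mulr0.
have vp : 0 < `|v| by rewrite normr_gt0.
have := hc (`|v|^-1 *: v); rewrite lL normrZ normfV normr_id ler_pdivlMl// mulrC; apply.
by rewrite inE /S /= normrZ normfV normr_id mulVf// gt_eqF.
Qed.

(** The derivative is bounded on the product of [K] and the unit ball, and convexity keeps the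
    segment between two points inside [K]. *)
Lemma lipschitz_compact_convex V W (f : V -> W) (K : set V) :
  compact_unit_ball V -> compact K ->
  (forall x y (s : R), K x -> K y -> 0 <= s <= 1 -> K (x + s *: (y - x))) ->
  MB 1 [set: V] f -> exists2 L : R, 0 < L &
    forall x y, K x -> K y -> `|f y - f x| <= L * `|y - x|.
Proof.
move=> cV cK convK hf.
have cKV := compact_setX cK cV.
have cD : {within K `*` [set v : V | `|v| <= 1],
    continuous (fun z : V * V => 'D_(z.2) f z.1)}.
  by apply: continuous_subspaceT => -[x v]; exact: MB_derive_continuous hf _.
have /ex_strict_bound_gt0[L L0 hL] := compact_bounded (continuous_compact cD cKV).
have hD x v : K x -> `|'D_v f x| <= L * `|v|.
  move=> Kx; have [->|v0] := eqVneq v 0; first by rewrite derive0 !normr0 mulr0.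
  have vp : 0 < `|v| by rewrite normr_gt0.
  have : `|'D_(`|v|^-1 *: v) f x| < L.
    apply: hL; exists (x, `|v|^-1 *: v) => //; split=> //=.
    by rewrite normrZ normfV normr_id mulVf// gt_eqF.
  rewrite derive_dirZ; last exact: MB_derivable hf _.
  by rewrite normrZ normfV normr_id => /ltW; rewrite ler_pdivrMl// mulrC.
exists L => // x y Kx Ky.
have := @mean_value_ineq_dir _ _ _ f x (y - x) 0 (L * `|y - x|).
rewrite subr0 (_ : x + (y - x) = y); last by lmod R.
apply=> s s01; first exact: MB_derivable hf _.
by rewrite subr0; apply: hD; exact: convK.
Qed.

End FiniteDimension.

(** * Implicit functions *)

Section Implicit.
Variable R : realType.
Implicit Types V W Z P Y : normedModType R.

Lemma is_derive_compMB V W Z (U' : set W) (f : V -> W) (g : W -> Z) (x v : V) (w : W) :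
  open U' -> MB 1 U' g -> U' (f x) -> is_derive x v f w ->
  is_derive x v (fun t => g (f t)) ('D_w g (f x)).
Proof.
move=> oU' hg U'fx df; apply: is_derive_comp => //.
  by apply: filterS (open_near oU' U'fx) => y U'y u; exact: MB_derivable hg _.
exact: MB_derive_continuous hg _.
Qed.

Lemma continuous_linear_comp V W Z (L : V -> W) (L' : W -> Z) :
  continuous_linear L -> continuous_linear L' -> continuous_linear (fun x => L' (L x)).
Proof.
move=> [l c] [l' c']; split=> [a u v|x]; first by rewrite l l'.
by apply: continuous_comp; [exact: c|exact: c'].
Qed.

Lemma continuous_linear_pair V W Z (L : V -> W) (L' : V -> Z) :
  continuous_linear L -> continuous_linear L' -> continuous_linear (fun x => (L x, L' x)).
Proof.
move=> [l c] [l' c']; split=> [a u v|x]; first by rewrite l l'.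
by apply: continuous_pair; [exact: c|exact: c'].
Qed.

Lemma derive_continuous_linear V W (U : set V) (f : V -> W) (x : V) :
  open U -> MB 1 U f -> U x -> continuous_linear (fun v => 'D_v f x).
Proof.
move=> oU hf Ux; split=> [a u v|v].
  rewrite (derive_dirD _ _ oU hf Ux) derive_dirZ//; exact: MB_derivable hf _.
apply: (@continuous_comp _ _ _ (fun v => (x, v)) (fun z : V * V => 'D_(z.2) f z.1)).
  by apply: continuous_pair; [exact: cvg_cst|exact: cvg_id].
exact: MB_derive_continuous hf _.
Qed.

Section FirstOrder.
Variables (P Y Z : normedModType R) (U : set P) (O : set (P * Y)) (G : P * Y -> Z).
Variable h : P -> Y.
Hypotheses (cP : compact_unit_ball P) (cY : compact_unit_ball Y).
Hypotheses (oU : open U) (oO : open O) (hO : forall p, U p -> O (p, h p)).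
Hypothesis hG : MB 1 O G.
Hypothesis G0 : forall p, U p -> G (p, h p) = 0.
Hypothesis ch : forall p, U p -> {for p, continuous h}.
Hypothesis injG : forall p w, U p -> 'D_(0, w) G (p, h p) = 0 -> w = 0.
Hypothesis surG : forall p z, U p -> exists w, 'D_(0, w) G (p, h p) = z.

Let cPY : compact_unit_ball (P * Y)%type.
Proof. exact: compact_unit_ball_prod. Qed.

Lemma partial_bounded_below p : U p ->
  exists2 c : R, 0 < c & forall w, c * `|w| <= `|'D_(0, w) G (p, h p)|.
Proof.
move=> Up; have [lD cD] := derive_continuous_linear oO hG (hO Up).
apply: injective_bounded_below => //.
- move=> w; apply: (@continuous_comp _ _ _ (fun w => (0, w)) (fun v => 'D_v G (p, h p))).
    by apply: continuous_pair; [exact: cvg_cst|exact: cvg_id].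
  exact: cD.
- move=> a w; rewrite -derive_dirZ; last by apply: MB_derivable hG _; exact: hO.
  rewrite (_ : (0, a *: w) = a *: (0, w) :> P * Y)//.
  by rewrite -[RHS]/(a *: 0, a *: w) scaler0.
- by move=> w; exact: injG.
Qed.

Lemma derive_split p u w : U p ->
  'D_(u, w) G (p, h p) = 'D_(u, 0) G (p, h p) + 'D_(0, w) G (p, h p).
Proof.
move=> Up; rewrite -(derive_dirD _ _ oO hG (hO Up)).
by rewrite -[_ + _]/(u + 0, 0 + w) addr0 add0r.
Qed.

(** Only continuity of [h] is known. Strict differentiability of [G] compares the two zeros over [p]
    and [p + t *: u], and the lower bound on the partial differential converts this into an estimate
    for the increment of [h]. *)
Lemma implicit_is_derive p u : U p ->
  exists2 w, is_derive p u h w & 'D_(u, w) G (p, h p) = 0.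
Proof.
move=> Up.
have [w Dw] := surG (- 'D_(u, 0) G (p, h p)) Up.
exists w; last by rewrite derive_split// Dw subrr.
have [c c0 hc] := partial_bounded_below Up.
apply/is_derive_normP => e e0.
pose K := `|u| + `|w| + 1; have K0 : 0 < K by rewrite /K ltr_wpDl// addr_ge0.
(* The first bound allows the error term on the right to be absorbed by half of the left-hand side;
   the second turns the rest into [e] times the length of [t]. *)
pose eta := Num.min (c / 2) (e * c / (2 * K)).
have eta0 : 0 < eta by rewrite lt_min !divr_gt0 ?mulr_gt0.
have [d d0 [_ hd]] := strict_derive cPY oO hG (hO Up) eta0.
have /continuous_normP/(_ _ d0)[d1 d10 hd1] := ch Up.
have /near_normP[d2 d20 hd2] := open_near oU Up.
pose K' := `|u| + 1; have K'0 : 0 < K' by rewrite ltr_wpDl.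
apply/near_normP; exists (Num.min d (Num.min d1 d2) / K').
  by rewrite divr_gt0// !lt_min d0 d10.
move=> t; rewrite subr0 ltr_pdivlMr// !lt_min => /and3P[td td1 td2].
have tu : `|p + t *: u - p| <= `|t| * K'.
  rewrite (_ : _ - p = t *: u); last by lmod R.
  by rewrite normrZ ler_wpM2l// lerDl.
have Upt : U (p + t *: u) by apply: hd2; exact: le_lt_trans td2.
have := hd (p, h p) (p + t *: u, h (p + t *: u)).
rewrite subrr normr0 d0 !G0// subrr => /(_ isT).
rewrite prod_norm_lt /= (le_lt_trans tu td) /= hd1; last exact: le_lt_trans td1.
move=> /(_ isT).
set D := h (p + t *: u) - h p.
have -> : (p + t *: u, h (p + t *: u)) - (p, h p) = (t *: u, D).
  by rewrite -[_ - _]/(p + t *: u - p, D); congr pair; lmod R.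
(* The differential kills [(u, w)], so subtracting [t *: (u, w)] from the direction leaves a purely
   partial derivative. *)
have -> : 'D_(t *: u, D) G (p, h p) = 'D_(0, D - t *: w) G (p, h p).
  have lD := (derive_continuous_linear oO hG (hO Up)).1.
  rewrite derive_split// (_ : (t *: u, 0) = t *: (u, 0) + 0); last first.
    by rewrite addr0 -[t *: (u, 0)]/(t *: u, t *: 0) scaler0.
  rewrite lD derive0 addr0.
  rewrite (_ : (0, D - t *: w) = (- t) *: (0, w) + (0, D)); last first.
    rewrite -[RHS]/((- t) *: 0 + 0, (- t) *: w + D) scaler0 addr0; congr pair.
    by lmod R.
  by rewrite lD Dw scalerN scaleNr opprK.
rewrite sub0r normrN => hh.
have h1 := le_trans (hc _) hh.
have nD : `|(t *: u, D)| <= `|t| * (`|u| + `|w|) + `|D - t *: w|.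
  rewrite prod_norm_le /= normrZ mulrDr; apply/andP; split.
    by rewrite -addrA lerDl addr_ge0// mulr_ge0.
  rewrite {1}(_ : D = (D - t *: w) + t *: w); last by lmod R.
  by rewrite (le_trans (ler_normD _ _))// normrZ addrC lerD2r lerDr mulr_ge0.
rewrite -/D.
have h2 : c * `|D - t *: w| <= eta * (`|t| * (`|u| + `|w|)) + c / 2 * `|D - t *: w|.
  apply: (le_trans h1); apply: (le_trans (ler_wpM2l (ltW eta0) nD)).
  by rewrite mulrDr lerD2l ler_wpM2r// /eta ge_min lexx.
have h3 : eta * (`|t| * (`|u| + `|w|)) <= e * c / (2 * K) * (`|t| * K).
  apply: ler_pM => //; rewrite ?mulr_ge0 ?addr_ge0// ?(ltW eta0)//.
    by rewrite /eta ge_min lexx orbT.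
  by rewrite ler_wpM2l// /K lerDl.
have h4 : e * c / (2 * K) * (`|t| * K) = c / 2 * (e * `|t|) by field; rewrite gt_eqF.
rewrite -(ler_pM2l (_ : 0 < c / 2)) ?divr_gt0// -h4.
by apply: le_trans h3; rewrite -lerBlDr in h2; apply: le_trans h2; lra.
Qed.

(** At nearby points the derivatives of [h] solve linear equations with nearby coefficients.
    Uniformity of the differential of [G] over directions preserves half of the lower bound on its
    partial, and this controls the difference of the two derivatives. *)
Lemma implicit_MB1 :
  MB 1 U h /\ forall p u, U p -> 'D_(u, 'D_u h p) G (p, h p) = 0.
Proof.
have D0 p u : U p -> 'D_(u, 'D_u h p) G (p, h p) = 0.
  by move=> Up; have [w [_ ->]] := implicit_is_derive u Up.
split=> //; split=> //; split.
  by move=> p u Up; have [w []] := implicit_is_derive u Up.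
move=> -[p u] [/= Up _]; apply/continuous_normP => e e0 /=.
have [c c0 hc] := partial_bounded_below Up.
have c20 : 0 < c / 2 by rewrite divr_gt0.
have /near_normP[d1 d10 hd1] := derive_uniform cPY oO hG (hO Up) c20.
set w0 := 'D_u h p.
have ec0 : 0 < c / 2 * e by rewrite mulr_gt0.
have /continuous_normP/(_ _ ec0)[d2 d20 hd2] :=
  MB_derive_continuous (v := (u, w0)) hG (hO Up).
pose d3 := Num.min d1 d2; have d30 : 0 < d3 by rewrite lt_min d10.
have /continuous_normP/(_ _ d30)[d4 d40 hd4] := ch Up.
have /near_normP[d5 d50 hd5] := open_near oU Up.
exists (Num.min d3 (Num.min d4 d5)); first by rewrite !lt_min d10 d20 d40.
move=> [p' u']; rewrite prod_norm_lt /= !lt_min.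
move=> /andP[/andP[/andP[a1 a2] /andP[a4 a5]] /andP[/andP[b1 b2] /andP[b4 b5]]].
have Up' := hd5 _ a5.
have := hd4 _ a4; rewrite lt_min => /andP[h1 h2].
have [|_ hu] := hd1 (p', h p'); first by rewrite prod_norm_lt /= a1 h1.
have := hd2 ((p', h p'), (u', w0)).
rewrite !prod_norm_lt /= a2 h2 b2 subrr normr0 d20 => /(_ isT).
rewrite [X in _ - X]D0// subr0.
set w' := 'D_u' h p'.
have -> : 'D_(u', w0) G (p', h p') = 'D_(0, w0 - w') G (p', h p').
  have := D0 p' u' Up'; rewrite -/w' => Dw'.
  rewrite (_ : (u', w0) = (u', w') + (0, w0 - w')); last first.
    by rewrite -[RHS]/(u' + 0, w' + (w0 - w')) addr0; congr pair; lmod R.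
  by rewrite (derive_dirD _ _ oO hG (hO Up')) Dw' add0r.
move=> hlt; rewrite distrC -(ltr_pM2l c20); apply: le_lt_trans hlt.
have k1 := hc (w0 - w'); have k2 := hu (0, w0 - w').
have k3 : `|(0 : P, w0 - w')| = `|w0 - w'| by rewrite prod_normE /= normr0 max_r.
have k4 : `|'D_(0, w0 - w') G (p, h p)| <= `|'D_(0, w0 - w') G (p', h p')| +
    `|'D_(0, w0 - w') G (p', h p') - 'D_(0, w0 - w') G (p, h p)|.
  apply: le_trans (ler_normB _ _).
  by rewrite subKr.
rewrite k3 in k2; move: k1 k2 k4; lra.
Qed.

End FirstOrder.

(* Differentiating [G (p, h p) = 0] shows that [(h, 'D h)] solves a system of the same
   kind whose partial differential is block triangular; this trades one derivative of
   [h] for one of [G]. *)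
Lemma implicit_MB k P Y Z (U : set P) (O : set (P * Y)) (G : P * Y -> Z) (h : P -> Y) :
  compact_unit_ball P -> compact_unit_ball Y -> open U -> open O ->
  (forall p, U p -> O (p, h p)) -> MB k.+1 O G ->
  (forall p, U p -> G (p, h p) = 0) ->
  (forall p, U p -> {for p, continuous h}) ->
  (forall p w, U p -> 'D_(0, w) G (p, h p) = 0 -> w = 0) ->
  (forall p z, U p -> exists w, 'D_(0, w) G (p, h p) = z) ->
  MB k.+1 U h.
Proof.
elim: k P Y Z U O G h => [|k IH] P Y Z U O G h cP cY oU oO hO hG G0 ch injG surG.
  by have [] := implicit_MB1 cP cY oU oO hO hG G0 ch injG surG.
have hG1 : MB 1 O G.
  by elim: (k) hG => [|j IHj] hj; [exact: MB_S|apply: IHj; exact: MB_S].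
have [hh1 D0] := implicit_MB1 cP cY oU oO hO hG1 G0 ch injG surG.
split=> //; split; first by move=> p u Up; exact: MB_derivable hh1 _.
pose p1 (z : (P * P) * (Y * Y)) : P * Y := (z.1.1, z.2.1).
pose p2 (z : (P * P) * (Y * Y)) : (P * Y) * (P * Y) := ((z.1.1, z.2.1), (z.1.2, z.2.2)).
pose DG (z : (P * Y) * (P * Y)) := 'D_(z.2) G z.1.
pose G2 z := (G (p1 z), DG (p2 z)).
pose O2 := [set z | O (p1 z)].
pose h2 (q : P * P) := (h q.1, 'D_(q.2) h q.1).
have lf A B := @continuous_linear_fst R A B; have ls A B := @continuous_linear_snd R A B.
have lp1 : continuous_linear p1.
  apply: continuous_linear_pair.
    exact: (continuous_linear_comp (lf _ _) (lf _ _)).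
  exact: (continuous_linear_comp (ls _ _) (lf _ _)).
have lp2 : continuous_linear p2.
  apply: continuous_linear_pair => //; apply: continuous_linear_pair.
    exact: (continuous_linear_comp (lf _ _) (ls _ _)).
  exact: (continuous_linear_comp (ls _ _) (ls _ _)).
have oO2 : open O2.
  by apply: open_comp => // z _; exact: lp1.2.
have oOT : open (O `*` [set: P * Y]) by exact: openXT.
have hDG : MB k.+1 (O `*` [set: P * Y]) DG by exact: MB_derive hG.
have hDG1 : MB 1 (O `*` [set: P * Y]) DG.
  by elim: (k) hDG => [//|j IHj] hj; apply: IHj; exact: MB_S.
have oUT : open (U `*` [set: P]) by exact: openXT.
have cPY := compact_unit_ball_prod cP cY.
have derG2 q w w' : U q.1 ->
    'D_(0, (w, w')) G2 (q, h2 q) = ('D_(0, w) G (q.1, h q.1),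
      'D_((0, w), 0) DG (p2 (q, h2 q)) + 'D_(0, w') G (q.1, h q.1)).
  move=> Uq; have Oq := hO _ Uq.
  have d1 : is_derive (q, h2 q) (0, (w, w')) (fun z => G (p1 z))
      ('D_(0, w) G (q.1, h q.1)).
    apply: (is_derive_compMB oO hG1 Oq).
    exact: (@is_derive_continuous_linear _ _ _ p1 (q, h2 q) (0, (w, w')) lp1).
  have d2 : is_derive (q, h2 q) (0, (w, w')) (fun z => DG (p2 z))
      ('D_((0, w), (0, w')) DG (p2 (q, h2 q))).
    apply: (is_derive_compMB oOT hDG1) => //.
    exact: (@is_derive_continuous_linear _ _ _ p2 (q, h2 q) (0, (w, w')) lp2).
  have [_ ->] := is_derive_pair d1 d2.
  congr pair.
  rewrite (_ : ((0, w), (0, w')) = ((0, w), 0) + (0, (0, w')) :> (P * Y) * (P * Y)); last first.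
    by rewrite -[RHS]/((0, w) + 0, 0 + (0, w')) addr0 add0r.
  rewrite (derive_dirD _ _ oOT hDG1) //; congr (_ + _).
  (* [DG] is linear in its second argument, so here the remainder vanishes identically. *)
  have [_ ->] // : is_derive (p2 (q, h2 q)) (0, (0, w')) DG ('D_(0, w') G (q.1, h q.1)).
  apply/is_derive_normP => e e0; near=> t.
  rewrite (_ : _ - _ - _ = 0) ?normr0 ?mulr_ge0// ?ltW//.
  rewrite (_ : p2 (q, h2 q) + t *: (0, (0, w')) =
    ((q.1, h q.1), t *: (0, w') + (q.2, 'D_(q.2) h q.1))); last first.
    rewrite [t *: (0, w') + _]addrC.
    rewrite -[LHS]/((q.1, h q.1) + t *: 0, (q.2, 'D_(q.2) h q.1) + t *: (0, w')).
    by rewrite scaler0 addr0.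
  by rewrite /DG /= (derive_continuous_linear oO hG1 Oq).1 addrK subrr.
have hh2 : MB k.+1 (U `*` [set: P]) h2.
  apply: (IH _ _ _ _ O2 G2) => //.
  - exact: compact_unit_ball_prod.
  - exact: compact_unit_ball_prod.
  - by move=> [p u] [/= Up _]; exact: hO.
  - apply: MB_pair => //.
      apply: (MB_comp (f := p1) (g := G) oO2 oO) => //; first exact: MB_linear.
      exact: MB_S.
    apply: (MB_comp (f := p2) (g := DG) oO2 oOT) => //.
    exact: MB_linear.
  - by move=> [p u] [/= Up _]; rewrite /G2 /= G0//; congr pair; exact: D0.
  - move=> [p u] [/= Up _]; apply: continuous_pair.
      by apply: continuous_comp; [exact: cvg_fst|exact: ch].
    exact: MB_derive_continuous hh1 _.
  - move=> q [w w'] [Uq _]; rewrite derG2// => -[/injG w0].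
    rewrite w0// derive0 add0r => /injG ->//.
  - move=> q [z z'] [Uq _].
    have [w Dw] := surG _ z Uq.
    have [w' Dw'] := surG _ (z' - 'D_((0, w), 0) DG (p2 (q, h2 q))) Uq.
    by exists (w, w'); rewrite derG2// Dw Dw' addrC subrK.
exact: (MB_snd oUT hh2).
Unshelve. all: by end_near. Qed.

End Implicit.

(** * Euclidean minimisation and local solvability *)

Section RowVectors.
Variables (R : realType) (n : nat).
Notation vec := 'rV[R]_n.
Implicit Types V W P : normedModType R.

Lemma coord_norm_le (y : vec) i : `|y 0 i| <= `|y|.
Proof. by rewrite [leRHS]mx_normrE; exact: (le_bigmax _ _ (ord0, i)). Qed.

Lemma rV_norm_le (y : vec) (B : R) : 0 <= B -> (forall i, `|y 0 i| <= B) -> `|y| <= B.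
Proof.
move=> B0 h; rewrite [leLHS]mx_normrE; apply: bigmax_le => // -[i j] _ /=.
by rewrite (ord1 i); exact: h.
Qed.

(** The norm of ['rV[R]_n] is the sup norm, which is not differentiable; minimisation and energy
    estimates use the Euclidean square instead. *)
Definition sqn (y : vec) : R := \sum_i y 0 i ^+ 2.

Lemma sqn_ge0 (y : vec) : 0 <= sqn y.
Proof. by apply: sumr_ge0 => i _; exact: sqr_ge0. Qed.

Lemma sqr_coord_le_sqn (y : vec) i : y 0 i ^+ 2 <= sqn y.
Proof.
by rewrite /sqn (bigD1 i)//= lerDl; apply: sumr_ge0 => j _; exact: sqr_ge0.
Qed.

Lemma sqr_norm_le_sqn (y : vec) : `|y| ^+ 2 <= sqn y.
Proof.
rewrite -[leRHS]sqr_sqrtr ?sqn_ge0// lerXn2r ?nnegrE ?sqrtr_ge0//.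
apply: rV_norm_le; first exact: sqrtr_ge0.
by move=> i; rewrite -sqrtr_sqr ler_sqrt ?sqn_ge0// sqr_coord_le_sqn.
Qed.

Lemma sqn_le_sqr_norm (y : vec) : sqn y <= n%:R * `|y| ^+ 2.
Proof.
rewrite /sqn; apply: (@le_trans _ _ (\sum_(i < n) `|y| ^+ 2)).
  apply: ler_sum => i _; rewrite -real_normK ?num_real//.
  by rewrite lerXn2r ?nnegrE//; exact: coord_norm_le.
by rewrite sumr_const card_ord mulr_natl.
Qed.

Lemma sqn_eq0 (y : vec) : sqn y <= 0 -> y = 0.
Proof.
move=> h; apply/eqP; rewrite -normr_eq0 -sqrf_eq0 eq_le sqr_ge0 andbT.
exact: le_trans (sqr_norm_le_sqn y) h.
Qed.

Lemma is_derive_coord V (g : V -> vec) x v w i :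
  is_derive x v g w -> is_derive x v (fun t => g t 0 i) (w 0 i).
Proof.
move=> /is_derive_normP h; apply/is_derive_normP => e /h; apply: filterS => t.
by apply: le_trans; rewrite (le_trans _ (coord_norm_le _ i))// !mxE.
Qed.

Lemma is_derive_sqn V (g : V -> vec) x v w :
  is_derive x v g w ->
  is_derive x v (fun t => sqn (g t)) (\sum_i 2 * g x 0 i * w 0 i).
Proof.
move=> dg.
have := @is_derive_sum R V R n (fun i => (fun t => g t 0 i) ^+ 2) x v
  (fun i => (2 * g x 0 i) *: w 0 i).
rewrite (_ : \sum_i _ = fun t => sqn (g t)); last first.
  apply/funext => t; rewrite fct_sumE /sqn; apply: eq_bigr => i _.
  by [].
by apply=> i; exact: (@is_deriveX R V (fun t => g t 0 i) 2 x v (w 0 i) (is_derive_coord i dg)).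
Qed.

Lemma continuous_sqn : continuous sqn.
Proof.
have lc i : MB 0 [set: vec] (fun y : vec => y 0 i).
  apply: MB_linear; split=> [a u v|]; [by rewrite !mxE|exact: coord_continuous].
have h : MB 0 [set: vec] (fun y : vec => \sum_i y 0 i *: y 0 i).
  by apply: MB_sum => [|i]; [exact: openT|apply: MB_scale => //; exact: openT].
by move=> y; exact: (MB_continuous (x := y) h).
Qed.

Lemma compact_closed_ball (c0 : vec) (r : R) : compact [set c | `|c - c0| <= r].
Proof.
apply: bounded_closed_compact.
  exists (`|c0| + r); split; first exact: num_real.
  move=> x Bx v /= vB; apply: le_trans (ltW Bx).
  rewrite (_ : v = c0 + (v - c0)); last by lmod R.
  by rewrite (le_trans (ler_normD _ _))// lerD2l.
apply: (@closed_comp _ _ (fun v : vec => `|v - c0|) [set x | x <= r]).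
  move=> x _; apply: continuous_comp; last exact: norm_continuous.
  exact: (MB_continuous (k := 0) (x := x) (MB_sub openT (MB_id 0 setT) (MB_cst 0 setT c0))).
exact: closed_le.
Qed.

(* At an interior minimum of [sqn \o g], moving so as to change [g] in its own
   direction cannot decrease [sqn \o g] to first order. *)
Lemma interior_min_zero (g : vec -> vec) (c0 : vec) (r : R) : 0 < r ->
  (forall c, `|c - c0| <= r -> {for c, continuous g}) ->
  (forall c w, `|c - c0| < r -> derivable g c w) ->
  (forall c z, `|c - c0| < r -> exists w, 'D_w g c = z) ->
  (forall c, `|c - c0| = r -> sqn (g c0) < sqn (g c)) ->
  exists2 c, `|c - c0| < r & g c = 0.
Proof.
move=> r0 cg dg sg bg.
have B0 : [set c | `|c - c0| <= r] !=set0 by exists c0; rewrite /= subrr normr0 ltW.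
have [] := EVT_min_rV (f := fun c => sqn (g c)) B0 (@compact_closed_ball c0 r).
  apply: continuous_in_subspaceT => c /set_mem cr.
  apply: (@continuous_comp _ _ _ g sqn).
    exact: cg.
  exact: continuous_sqn.
move=> c /set_mem /= cr minc.
have c0r : `|c - c0| < r.
  rewrite lt_neqAle cr andbT; apply/eqP => /bg; rewrite ltNge minc//.
  by rewrite inE /= subrr normr0 ltW.
exists c => //.
have [w Dw] := sg c (g c) c0r.
pose K := `|w| + 1; have K0 : 0 < K by rewrite ltr_wpDl.
pose e := (r - `|c - c0|) / K.
have e0 : 0 < e by rewrite divr_gt0// subr_gt0.
have inr (t : R) : t \in `](- e), e[%R -> `|c + t *: w - c0| < r.
  rewrite in_itv /= -ltr_norml ltr_pdivlMr// => te.
  rewrite (_ : _ - c0 = (c - c0) + t *: w); last by lmod R.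
  apply: (le_lt_trans (ler_normD _ _)); rewrite -ltrBrDl; apply: le_lt_trans te.
  by rewrite normrZ ler_wpM2l// lerDl.
pose phi (t : R) := sqn (g (c + t *: w)).
have dphi (t : R) : t \in `](- e), e[%R -> is_derive t 1 phi
    (\sum_i 2 * g (c + t *: w) 0 i * ('D_w g (c + t *: w)) 0 i).
  move=> /inr te; apply: is_derive_sqn.
  apply: (is_derive_shiftP g c w t _).1; apply: derivableP; exact: dg.
have e0' : 0 \in `](- e), e[%R by rewrite in_itv /= oppr_lt0 e0.
have : is_derive (0 : R) 1 phi 0.
  apply: (@derive1_at_min _ phi (- e) e 0) => //.
  - by rewrite ge0_cp// ltW.
  - by move=> t /dphi[].
  - move=> t /inr te; rewrite /phi scale0r addr0; apply: minc.
    by rewrite inE /= ltW.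
move=> [_]; have [_ ->] := dphi _ e0'; rewrite scale0r addr0 Dw => h.
apply: sqn_eq0; rewrite -(ler_pM2l (_ : (0 : R) < 2))// mulr0 -h.
by rewrite /sqn mulr_sumr; apply: ler_sum => i _; rewrite expr2 mulrA.
Qed.

Lemma linear_injective_surjective (L : vec -> vec) :
  (forall (a : R) u v, L (a *: u + v) = a *: L u + L v) ->
  (forall v, L v = 0 -> v = 0) -> forall z, exists v, L v = z.
Proof.
move=> lL iL z.
pose M := \matrix_i L (delta_mx 0 i).
have L0 : L 0 = 0 by have := lL (-1) 0 0; rewrite !scaleN1r oppr0 addr0 addNr.
have LM v : L v = v *m M.
  rewrite [in LHS](row_sum_delta v) mulmx_sum_row.
  under [RHS]eq_bigr do rewrite rowK.
  elim: (index_enum 'I_n) => [|i s IH]; first by rewrite !big_nil.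
  by rewrite !big_cons lL IH.
have Mu : M \in unitmx.
  by rewrite -row_free_unit; apply: inj_row_free => v; rewrite -LM; exact: iL.
by exists (z *m invmx M); rewrite LM mulmxKV.
Qed.

(** * Existence of zeros near a nondegenerate zero *)

Section LocalSolvability.
Variables (P : normedModType R) (O : set (P * vec)) (G : P * vec -> vec).
Variables (p0 : P) (c0 : vec).
Hypotheses (cP : compact_unit_ball P) (oO : open O) (hG : MB 1 O G).
Hypothesis (O0 : O (p0, c0)).
Hypothesis inj0 : forall w, 'D_(0, w) G (p0, c0) = 0 -> w = 0.

Let cPY : compact_unit_ball (P * vec)%type.
Proof. by apply: compact_unit_ball_prod => //; exact: compact_unit_ball_rV. Qed.

Lemma partial_continuous_linear z : O z -> continuous_linear (fun w : vec => 'D_(0, w) G z).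
Proof.
move=> Oz; apply: (@continuous_linear_comp _ _ _ _ (fun w : vec => (0 : P, w))).
  split=> [a u v|w]; first by rewrite -[RHS]/(a *: 0 + 0, a *: u + v) scaler0 addr0.
  by apply: continuous_pair; [exact: continuous_cst_at|exact: continuous_id_at].
exact: derive_continuous_linear hG Oz.
Qed.

(** The constant at the base point is double the nearby one, so that an error [k] in the linear
    approximation still leaves a lower bound [k]. *)
Lemma partial_bounded_below_near : exists2 k : R, 0 < k &
  (forall w, 2 * k * `|w| <= `|'D_(0, w) G (p0, c0)|) /\
  \forall z \near (p0, c0), O z /\ forall w : vec, k * `|w| <= `|'D_(0, w) G z|.
Proof.
have [lD cD] := partial_continuous_linear O0.
have lDZ (a : R) v : 'D_(0, a *: v) G (p0, c0) = a *: 'D_(0, v) G (p0, c0).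
  rewrite -derive_dirZ; last exact: MB_derivable hG O0.
  rewrite (_ : (0, a *: v) = a *: (0, v) :> P * vec)//.
  by rewrite -[RHS]/(a *: 0, a *: v) scaler0.
have [k k0 hk] := injective_bounded_below (@compact_unit_ball_rV R n) cD lDZ inj0.
have k20 : 0 < k / 2 by rewrite divr_gt0.
exists (k / 2) => //; split; first by move=> w; rewrite mulrCA mulfV ?mulr1//; exact: hk.
apply: filterS (derive_uniform cPY oO hG O0 k20) => z [Oz hz]; split=> // w.
have := hk w; have := hz (0, w).
rewrite (_ : `|(0 : P, w)| = `|w|); last by rewrite prod_normE /= normr0 max_r.
have : `|'D_(0, w) G (p0, c0)| <= `|'D_(0, w) G z| + `|'D_(0, w) G z - 'D_(0, w) G (p0, c0)|.
  by apply: le_trans (ler_normB _ _); rewrite subKr.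
lra.
Qed.

Lemma partial_bijective_near : \forall z \near (p0, c0), [/\ O z,
  (forall w : vec, 'D_(0, w) G z = 0 -> w = 0) &
  (forall y : vec, exists w, 'D_(0, w) G z = y)].
Proof.
have [k k0 [_]] := partial_bounded_below_near; apply: filterS => z [Oz hz].
have inj w : 'D_(0, w) G z = 0 -> w = 0.
  move=> h; have := hz w; rewrite h normr0 pmulr_rle0// normr_le0 => /eqP//.
split=> //; apply: linear_injective_surjective inj.
exact: (partial_continuous_linear Oz).1.
Qed.

(** On the sphere of radius [r] the linear part is at least [2 * k * r] and its error at most
    [k * r], while the value at the centre tends to [0] with [p]. Hence the minimum over the ball is
    interior, and [interior_min_zero] makes it a zero. *)
Lemma local_solvability (rho : R) : G (p0, c0) = 0 -> 0 < rho ->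
  \forall p \near p0, exists2 c, `|c - c0| < rho & O (p, c) /\ G (p, c) = 0.
Proof.
move=> G0 rho0.
have [k k0 [hk0 /near_normP[d1 d10 hd1]]] := partial_bounded_below_near.
have /near_normP[d2 d20 hd2] := partial_bijective_near.
have [d3 d30 [hd3O hd3]] := strict_derive cPY oO hG O0 k0.
pose d := Num.min (Num.min rho d1) (Num.min d2 d3).
have d0 : 0 < d by rewrite !lt_min rho0 d10 d20.
pose r := d / 2; have r0 : 0 < r by rewrite divr_gt0.
have rd : r < d by rewrite ltr_pdivrMr// mulr_natr mulr2n ltrDl.
have : {for p0, continuous (fun p => G (p, c0))}.
  apply: (@continuous_comp _ _ _ (fun p => (p, c0)) G).
    by apply: continuous_pair; [exact: continuous_id_at|exact: continuous_cst_at].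
  exact: MB_continuous hG _.
(* If the value at the centre has norm [s < s0], the values on the sphere exceed [(n + 1) * s] in
   norm. This beats the factor [n] lost in passing from the sup norm to [sqn]. *)
pose s0 := k * r / (n%:R + 2).
have n2 : 0 < n%:R + 2 :> R by rewrite ltr_wpDl.
have s00 : 0 < s0 by rewrite divr_gt0// mulr_gt0.
move=> /continuous_normP/(_ _ s00)[d4 d40 hd4].
apply/near_normP; exists (Num.min r d4); first by rewrite lt_min r0.
move=> p; rewrite lt_min => /andP[pr pd4].
have sG := hd4 _ pd4; rewrite G0 subr0 in sG.
have inb c : `|c - c0| <= r -> `|(p, c) - (p0, c0)| < d.
  move=> cr; rewrite prod_norm_lt /= (lt_trans pr rd) /=; exact: le_lt_trans rd.
have inb1 c : `|c - c0| <= r -> [/\ `|(p, c) - (p0, c0)| < d2,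
    `|(p, c) - (p0, c0)| < d3 & O (p, c)].
  move=> /inb; rewrite !lt_min => /andP[_ /andP[h2 h3]]; split=> //.
  exact: hd3O.
have dGc c w : `|c - c0| <= r -> is_derive c w (fun c => G (p, c)) ('D_(0, w) G (p, c)).
  move=> /inb1[_ _ Opc].
  apply: (is_derive_compMB (f := fun c => (p, c)) oO hG Opc).
  by apply: is_derive_pair.
have [] := @interior_min_zero (fun c => G (p, c)) c0 r r0.
- move=> c /inb1[_ _ Opc]; apply: (@continuous_comp _ _ _ (fun c => (p, c)) G).
    by apply: continuous_pair; [exact: continuous_cst_at|exact: continuous_id_at].
  exact: MB_continuous hG _.
- by move=> c w /ltW cr; have [] := dGc c w cr.
- move=> c z /ltW cr; have [h2 _ _] := inb1 _ cr; have [_ _ /(_ z)[w Dw]] := hd2 _ h2.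
  by exists w; have [_ ->] := dGc c w cr.
- move=> c cr.
  have cr' : `|c - c0| <= r by rewrite cr.
  have [_ h3 _] := inb1 c cr'.
  have c0r : `|c0 - c0| <= r by rewrite subrr normr0 ltW.
  have [_ h30 _] := inb1 c0 c0r.
  have := hd3 _ _ h30 h3.
  have -> : (p, c) - (p, c0) = (0, c - c0) by rewrite -[LHS]/(p - p, c - c0) subrr.
  rewrite (_ : `|(0 : P, c - c0)| = r); last by rewrite prod_normE /= normr0 max_r.
  have := hk0 (c - c0); rewrite cr.
  set Dc := 'D_(0, c - c0) G (p0, c0) => k1 k2.
  have k3 : `|Dc| <= `|G (p, c)| + `|G (p, c0)| + `|G (p, c) - G (p, c0) - Dc|.
    rewrite (le_trans _ (lerD (ler_normB _ _) (lexx _)))//.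
    by apply: le_trans (ler_normB _ _); rewrite subKr.
  have k4 : k * r = (n%:R + 2) * s0 by rewrite /s0 [RHS]mulrC divfK// gt_eqF.
  set s := `|G (p, c0)| in sG k3 *; set a := `|G (p, c)| in k3 *.
  have k5 : (n%:R + 2) * s < k * r by rewrite k4 ltr_pM2l.
  have k6 : (n%:R + 1) * s < a by move: k1 k2 k3 k5; lra.
  apply: (le_lt_trans (sqn_le_sqr_norm _)); apply: lt_le_trans (sqr_norm_le_sqn _).
  rewrite -/s -/a; have s0' : 0 <= s by exact: normr_ge0.
  have n0 : 0 <= n%:R :> R by exact: ler0n.
  apply: (@le_lt_trans _ _ (((n%:R + 1) * s) ^+ 2)).
    rewrite exprMn ler_wpM2r ?sqr_ge0//; nra.
  by rewrite ltrXn2r// ?nnegrE// ?mulr_ge0 ?addr_ge0//.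
move=> c cr Gc; exists c; last by have [_ _] := inb1 c (ltW cr).
by apply: (lt_trans cr); apply: (lt_le_trans rd); rewrite /d !ge_min lexx.
Qed.

End LocalSolvability.

End RowVectors.

(** * Second order equations *)

Section Gronwall.
Variable R : realType.

Lemma is_derive_expRM (k t : R) : is_derive t 1 (fun s : R => expR (k * s)) (k * expR (k * t)).
Proof.
have h : is_derive t 1 (fun s : R => k * s) k.
  have := @is_derive_continuous_linear R R R (fun s => k * s) t 1.
  rewrite mulr1; apply; split; last by move=> x; exact: mulrl_continuous.
  by move=> a u v; rewrite mulrDr -[a *: u]/(a * u) -[a *: (k * u)]/(a * (k * u)) mulrCA.
have := @is_derive1_comp R expR (fun s => k * s) t _ _ (is_derive_expR _) h.
by rewrite mulrC.
Qed.

(** The function [E u * expR (- K * u)] is nonincreasing. *)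
Lemma le_derive_exp (E dE : R -> R) (lo hi K : R) :
  (forall t : R, lo <= t <= hi -> is_derive t 1 E (dE t)) ->
  (forall t : R, lo <= t <= hi -> dE t <= K * E t) ->
  forall s t : R, lo <= s -> s <= t -> t <= hi -> E t <= E s * expR (K * (t - s)).
Proof.
move=> hE hK s t los st thi.
pose phi (u : R) := E u * expR (- K * u).
have dphi (u : R) : lo <= u <= hi ->
    is_derive u 1 phi ((dE u - K * E u) * expR (- K * u)).
  move=> lu; have h1 := hE u lu; have h2 := is_derive_expRM (- K) u.
  rewrite (_ : _ * _ = E u *: (- K * expR (- K * u)) + expR (- K * u) *: dE u).
    exact: (@is_deriveM R R E (fun s : R => expR (- K * s)) u 1 _ _ h1 h2).
  rewrite -[E u *: _]/(E u * (- K * expR (- K * u))) -[_ *: dE u]/(expR (- K * u) * dE u).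
  by ring.
have cphi : {within `[lo, hi], continuous phi}.
  apply: continuous_in_subspaceT => u /set_mem /=; rewrite in_itv /= => lu.
  by apply: derivable_continuous1; have [] := dphi u lu.
have := @ler0_derive1_le_cc R phi lo hi.
have oo u : u \in `]lo, hi[%R -> lo <= u <= hi.
  by rewrite in_itv /= => /andP[/ltW -> /ltW ->].
move=> /(_ (fun u hu => let: DeriveDef h _ := dphi u (oo u hu) in h)).
have neg u : u \in `]lo, hi[%R -> (phi^`())%classic u <= 0.
  move=> /oo lu; rewrite derive1E; have [_ ->] := dphi u lu.
  by rewrite pmulr_lle0 ?expR_gt0// subr_le0 hK.
move=> /(_ neg cphi t s); rewrite !in_itv /= thi los (le_trans los st) (le_trans st thi).
move=> /(_ isT isT st); rewrite /phi.
rewrite -(ler_pM2r (expR_gt0 (K * t))) -!mulrA -!expRD mulNr addNr expR0 mulr1.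
by rewrite (_ : - K * s + K * t = K * (t - s))//; ring.
Qed.

(** A bound on the absolute value of [dE] survives time reversal, so for [t < s] the one-sided
    estimate is applied to [E (- u)]. *)
Lemma gronwall (E dE : R -> R) (lo hi K : R) :
  (forall t : R, lo <= t <= hi -> is_derive t 1 E (dE t)) ->
  (forall t : R, lo <= t <= hi -> `|dE t| <= K * E t) ->
  forall s t : R, lo <= s <= hi -> lo <= t <= hi -> E t <= E s * expR (K * `|t - s|).
Proof.
move=> hE hK s t /andP[los shi] /andP[lot thi].
have [st|/ltW ts] := leP s t.
  rewrite ger0_norm ?subr_ge0//; apply: (@le_derive_exp E dE lo hi) => // u /hK.
  exact/le_trans/ler_norm.
rewrite ler0_norm ?subr_le0//.
have := @le_derive_exp (fun u => E (- u)) (fun u => - dE (- u)) (- hi) (- lo) K _ _ (- s) (- t).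
rewrite !opprK => h; rewrite opprB [s - t]addrC; apply: h; rewrite ?lerN2//.
  move=> u; rewrite lerNl lerNr andbC => /hE h.
  have hN := is_derive_continuous_linear u 1 (@continuous_linear_opp R R).
  by have := is_derive1_comp h hN; rewrite mulrN1.
move=> u; rewrite lerNl lerNr andbC => /hK; apply: le_trans.
by rewrite -normrN ler_norm.
Qed.

End Gronwall.

(** * Stability, uniqueness and a priori bounds for solutions *)

Section ODE.
Variables (R : realType) (n : nat).
Notation vec := 'rV[R]_n.

Lemma mean_value_ineq_segment (W : normedModType R) (g : R -> W) (a b M : R) (c : W) :
  a <= b -> (forall s : R, a <= s <= b -> derivable g s 1) ->
  (forall s : R, a <= s <= b -> `|'D_1 g s - c| <= M) ->
  `|g b - g a - (b - a) *: c| <= (b - a) * M.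
Proof.
move=> ab dg hM.
have := @mean_value_ineq_dir _ _ _ g a (b - a) ((b - a) *: c) ((b - a) * M).
rewrite addrCA subrr addr0.
have ba : b - a = (b - a) *: (1 : R) by rewrite [_ *: _]mulr1.
have inab (t : R) : 0 <= t <= 1 -> a <= a + t *: (b - a) <= b.
  move=> /andP[t0 t1]; rewrite -[t *: _]/(t * (b - a)) lerDl mulr_ge0 ?subr_ge0//=.
  by rewrite -lerBrDl ler_piMl ?subr_ge0.
have dab (t : R) : 0 <= t <= 1 -> is_derive (a + t *: (b - a)) (b - a) g
    ((b - a) *: 'D_1 g (a + t *: (b - a))).
  move=> /inab/dg/derivableP/(is_derive_dirZ (b - a)).
  by rewrite -ba.
apply=> t t01; first by have [] := dab t t01.
have [_ ->] := dab t t01.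
rewrite -scalerBr normrZ ger0_norm ?subr_ge0// ler_wpM2l ?subr_ge0//.
by apply: hM; exact: inab.
Qed.

Lemma bounded_on_segment (W : normedModType R) (g : R -> W) (lo hi : R) :
  (forall t : R, {for t, continuous g}) -> exists2 B : R, 0 < B &
  forall t : R, lo <= t <= hi -> `|g t| <= B.
Proof.
move=> cg.
have cg' : {within `[lo, hi], continuous g} by apply: continuous_subspaceT => t; exact: cg.
have /ex_strict_bound_gt0[B B0 hB] :=
  compact_bounded (continuous_compact cg' (@segment_compact R lo hi)).
by exists B => // t tl; apply: ltW; apply: hB; exists t => //=; rewrite in_itv.
Qed.

(** Continuity method. At the infimum [T] of the times with [m] nonnegative, continuity gives
    [m T <= 0]; the hypothesis improves this to [m T < 0], which persists beyond [T] and contradicts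
    the choice of [T]. *)
Lemma continuity_bootstrap (m : R -> R) (lo hi : R) :
  (forall t : R, {for t, continuous m}) -> m lo < 0 ->
  (forall t : R, lo <= t <= hi -> (forall s : R, lo <= s <= t -> m s <= 0) -> m t < 0) ->
  forall t : R, lo <= t <= hi -> m t < 0.
Proof.
move=> cm m0 hm t1 t1lh; rewrite ltNge; apply/negP => mt1.
pose S := [set t | lo <= t <= hi /\ 0 <= m t].
have infS : has_inf S by split; [exists t1|exists lo => t [/andP[]]].
pose T := inf S.
have loT : lo <= T by apply: lb_le_inf; [exists t1|move=> t [/andP[]]].
have Tt1 : T <= t1 by apply: ge_inf; [exact: infS.2|].
have Thi : T <= hi by rewrite (le_trans Tt1)//; case/andP: t1lh.
have ltT s : lo <= s -> s < T -> m s < 0.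
  move=> los sT; rewrite ltNge; apply/negP => ms.
  have : T <= s.
    apply: ge_inf; first exact: infS.2.
    by split=> //; rewrite los (le_trans (ltW sT)).
  by rewrite leNgt sT.
have mT0 : m T <= 0.
  rewrite leNgt; apply/negP => mT.
  have /continuous_normP/(_ _ mT)[d d0 hd] := cm T.
  have [Tlo|Tlo] := eqVneq T lo; first by move: mT; rewrite Tlo ltNge (ltW m0).
  have loT' : lo < T by rewrite lt_neqAle eq_sym Tlo.
  pose s := Num.max lo (T - d / 2).
  have sT : s < T by rewrite gt_max loT' ltrBlDr ltrDl divr_gt0.
  have los : lo <= s by rewrite le_max lexx.
  have : `|s - T| < d.
    rewrite distrC ger0_norm ?subr_ge0 ?(ltW sT)// ltrBlDr -ltrBlDl lt_max.
    by apply/orP; right; rewrite ltrD2l ltrN2 ltr_pdivrMr// mulr_natr mulr2n ltrDl.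
  move=> /hd; have := ltT s los sT; rewrite distrC => ms.
  by rewrite ger0_norm ?subr_ge0 ?(ltW (lt_trans ms mT))//; lra.
have mT : m T < 0.
  apply: hm; first by rewrite loT.
  move=> s /andP[los]; rewrite le_eqVlt => /predU1P[->//|sT]; exact: ltW (ltT s los sT).
have mT' : 0 < - m T by rewrite oppr_gt0.
have /continuous_normP/(_ _ mT')[d d0 hd] := cm T.
have [u Su uT] := inf_adherent d0 infS.
have Tu : T <= u by apply: ge_inf => //; exact: infS.2.
have : `|u - T| < d by rewrite ger0_norm ?subr_ge0// ltrBlDl.
move=> /hd; case: Su => _ mu; rewrite ger0_norm ?subr_ge0 ?(le_trans (ltW mT))//.
by rewrite ltrBlDr addNr ltNge mu.
Qed.

Lemma dist_in_segment (lo hi s t : R) : lo <= s <= hi -> lo <= t <= hi -> `|t - s| <= hi - lo.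
Proof.
move=> /andP[s1 s2] /andP[t1 t2]; rewrite ler_norml.
by apply/andP; split; lra.
Qed.

Lemma normr_2M_le (p q : R) : `|2 * p * q| <= p ^+ 2 + q ^+ 2.
Proof.
rewrite ler_norml; have := sqr_ge0 (p + q); have := sqr_ge0 (p - q).
by rewrite !expr2 => h1 h2; apply/andP; split; nra.
Qed.

Lemma dist_max_lt (p q p' q' e : R) : `|p' - p| < e -> `|q' - q| < e ->
  `|Num.max p' q' - Num.max p q| < e.
Proof.
rewrite !ltr_norml => /andP[a1 a2] /andP[b1 b2].
by have [c1|c1] := leP p' q'; have [c2|c2] := leP p q; apply/andP; split; lra.
Qed.

Variable f : R -> vec -> vec -> vec.
Hypothesis hf : MB 1 [set: R * vec * vec] (uncurry3 f).

Notation sol := (complete_solution f).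

Lemma sol_is_derive x (t : R) : sol x -> is_derive t 1 x ('D_1 x t).
Proof. by move=> hx; have [h _] := hx t; exact: derivableP. Qed.

Lemma sol_is_derive2 x (t : R) : sol x -> is_derive t 1 (fun s => 'D_1 x s) (f t (x t) ('D_1 x t)).
Proof. by move=> hx; have [_ [h <-]] := hx t; exact: derivableP. Qed.

Lemma sol_continuous x (t : R) : sol x -> {for t, continuous x}.
Proof. by move=> hx; apply: derivable_continuous1; have [] := hx t. Qed.

Lemma sol_derive_continuous x (t : R) : sol x -> {for t, continuous (fun s => 'D_1 x s)}.
Proof. by move=> hx; apply: derivable_continuous1; have [_ []] := hx t. Qed.

Let cb : compact_unit_ball (R * vec * vec)%type.
Proof.
apply: compact_unit_ball_prod; last exact: compact_unit_ball_rV.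
apply: compact_unit_ball_prod; [exact: compact_unit_ball_R|exact: compact_unit_ball_rV].
Qed.

Definition phase_box (lo hi B : R) : set (R * vec * vec) :=
  [set` `[lo, hi]%R] `*` [set a : vec | `|a| <= B] `*` [set v : vec | `|v| <= B].

Lemma compact_phase_box lo hi B : compact (phase_box lo hi B).
Proof.
apply: compact_setX; last exact: compact_ball_rV.
by apply: compact_setX; [exact: segment_compact|exact: compact_ball_rV].
Qed.

Lemma convex_phase_box lo hi B x y (s : R) : phase_box lo hi B x -> phase_box lo hi B y ->
  0 <= s <= 1 -> phase_box lo hi B (x + s *: (y - x)).
Proof.
have convB (a b : vec) : `|a| <= B -> `|b| <= B -> 0 <= s <= 1 -> `|a + s *: (b - a)| <= B.
  move=> aB bB /andP[s0 s1]; rewrite (_ : _ + _ = (1 - s) *: a + s *: b); last by lmod R.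
  apply: (le_trans (ler_normD _ _)); rewrite !normrZ !ger0_norm ?subr_ge0//.
  have := ler_wpM2l s0 bB; have s1' : 0 <= 1 - s by rewrite subr_ge0.
  by have := ler_wpM2l s1' aB; lra.
case: x y => -[t a] v [[t' a'] v'] [[/= + aB] vB] [[/= + aB'] vB'] s01.
rewrite !in_itv /= => /andP[t1 t2] /andP[t1' t2'].
split; [split|] => /=; [|exact: convB..].
rewrite in_itv /= -[s *: _]/(s * (t' - t)); case/andP: s01 => s0 s1.
have s1' : 0 <= 1 - s by rewrite subr_ge0.
have := ler_wpM2l s1' t1; have := ler_wpM2l s1' t2.
have := ler_wpM2l s0 t1'; have := ler_wpM2l s0 t2'.
by move=> *; apply/andP; split; lra.
Qed.

(** Energy estimate for the difference of two solutions. The constant depends on the box and the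
    time interval only, and either of the two times may come first. *)
Lemma flow_stability (lo hi B : R) : exists2 K : R, 0 < K &
  forall x y, sol x -> sol y ->
  (forall t : R, lo <= t <= hi ->
    [/\ `|x t| <= B, `|'D_1 x t| <= B, `|y t| <= B & `|'D_1 y t| <= B]) ->
  forall s t : R, lo <= s <= hi -> lo <= t <= hi ->
  sqn (x t - y t) + sqn ('D_1 x t - 'D_1 y t) <=
    (sqn (x s - y s) + sqn ('D_1 x s - 'D_1 y s)) * K.
Proof.
have [L L0 hL] := lipschitz_compact_convex cb (@compact_phase_box lo hi B)
  (@convex_phase_box lo hi B) hf.
(* The derivative of the energy is at most [sqn d + 2 * sqn d' + sqn df], and the Lipschitz bound,
   taken in the sup norm, gives [sqn df <= n * L ^ 2 * E]. *)
pose K := 2 + n%:R * L ^+ 2.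
have K0 : 0 <= K by rewrite addr_ge0// mulr_ge0// sqr_ge0.
exists (expR (K * (hi - lo))); first exact: expR_gt0.
move=> x y hx hy hB s t sl tl.
pose d (t : R) := x t - y t; pose d' (t : R) := 'D_1 x t - 'D_1 y t.
pose df (t : R) := f t (x t) ('D_1 x t) - f t (y t) ('D_1 y t).
pose E (t : R) := sqn (d t) + sqn (d' t).
pose dE (t : R) := \sum_i 2 * d t 0 i * d' t 0 i + \sum_i 2 * d' t 0 i * df t 0 i.
have hE (u : R) : lo <= u <= hi -> is_derive u 1 E (dE u).
  move=> _; apply: (@is_deriveD R R R (fun t => sqn (d t)) (fun t => sqn (d' t))).
    apply: is_derive_sqn; apply: (@is_deriveB R R vec x y); exact: sol_is_derive.
  apply: is_derive_sqn.
  by apply: (@is_deriveB R R vec (fun s => 'D_1 x s) (fun s => 'D_1 y s)); exact: sol_is_derive2.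
have hdE (u : R) : lo <= u <= hi -> `|dE u| <= K * E u.
  move=> ul; have [B1 B2 B3 B4] := hB u ul.
  have key (p q : vec) : `|\sum_i 2 * p 0 i * q 0 i| <= sqn p + sqn q.
    apply: (le_trans (ler_norm_sum _ _ _)); rewrite /sqn -big_split /=.
    by apply: ler_sum => i _; exact: normr_2M_le.
  apply: (le_trans (ler_normD _ _)).
  apply: (le_trans (lerD (key _ _) (key _ _))).
  have hdf : sqn (df u) <= n%:R * L ^+ 2 * E u.
    apply: (le_trans (sqn_le_sqr_norm _)); rewrite -mulrA ler_wpM2l//.
    have := hL (u, y u, 'D_1 y u) (u, x u, 'D_1 x u).
    rewrite -[uncurry3 f (u, x u, 'D_1 x u) - _]/(df u) => h.
    have {}h : `|df u| <= L * `|((u, x u, 'D_1 x u) : R * vec * vec) - (u, y u, 'D_1 y u)|.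
      apply: h; (split; last by []); (split; last by []); by rewrite /= in_itv.
    rewrite -[_ - _]/(u - u, d u, d' u) subrr in h.
    apply: (@le_trans _ _ ((L * `|(0 : R, d u, d' u)|) ^+ 2)).
      by rewrite lerXn2r ?nnegrE ?mulr_ge0// ltW.
    rewrite exprMn ler_wpM2l ?sqr_ge0// !prod_normE /= normr0 [Num.max 0 _]max_r//.
    have k1 := sqr_norm_le_sqn (d u); have k2 := sqr_norm_le_sqn (d' u).
    have k3 := sqn_ge0 (d u); have k4 := sqn_ge0 (d' u).
    rewrite /Num.max; case: ifP => _.
      by apply: (le_trans k2); rewrite /E lerDr.
    by apply: (le_trans k1); rewrite /E lerDl.
  have := sqn_ge0 (d u); have := sqn_ge0 (d' u); rewrite /K /E in hdf *; lra.
have := @gronwall R E dE lo hi K hE hdE s t sl tl.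
move=> h; apply: (le_trans h); rewrite ler_wpM2l ?addr_ge0 ?sqn_ge0//.
by rewrite ler_expR ler_wpM2l//; exact: dist_in_segment.
Qed.

Lemma sol_bounded x y lo hi : sol x -> sol y -> exists B : R, forall t : R, lo <= t <= hi ->
  [/\ `|x t| <= B, `|'D_1 x t| <= B, `|y t| <= B & `|'D_1 y t| <= B].
Proof.
move=> hx hy.
have [B1 B10 h1] := bounded_on_segment lo hi (fun t => @sol_continuous _ t hx).
have [B2 B20 h2] := bounded_on_segment lo hi (fun t => @sol_derive_continuous _ t hx).
have [B3 B30 h3] := bounded_on_segment lo hi (fun t => @sol_continuous _ t hy).
have [B4 B40 h4] := bounded_on_segment lo hi (fun t => @sol_derive_continuous _ t hy).
exists (B1 + B2 + B3 + B4) => t tl.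
by split; [have := h1 t tl|have := h2 t tl|have := h3 t tl|have := h4 t tl]; lra.
Qed.

(** Lipschitz bounds for [f] are available on boxes only. Both solutions are bounded between [s] and
    [t], so one box contains them and stability applies with zero initial difference. *)
Lemma sol_unique x y s : sol x -> sol y -> x s = y s -> 'D_1 x s = 'D_1 y s -> x = y.
Proof.
move=> hx hy xys dxys; apply/funext => t.
have [B hB] := sol_bounded (Num.min s t) (Num.max s t) hx hy.
have [K K0 hK] := flow_stability (Num.min s t) (Num.max s t) B.
have := hK x y hx hy hB s t; rewrite !ge_min !le_max !lexx !orbT => /(_ isT isT).
rewrite xys dxys !subrr (_ : sqn 0 = 0); last first.
  by rewrite /sqn big1// => i _; rewrite mxE expr0n.
rewrite addr0 mul0r => h; apply/eqP; rewrite -subr_eq0; apply/eqP/sqn_eq0.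
by apply: le_trans h; rewrite lerDl sqn_ge0.
Qed.

(** [e] and [M] are chosen before the solution. While a solution stays in a fixed box its
    acceleration is at most [C], and for a short time this keeps it away from the bounds that define
    the box. *)
Lemma sol_apriori (al : R) (a : vec) (r : R) : 0 <= r ->
  exists2 e : R, 0 < e & exists M : R, forall x, sol x -> x al = a ->
    `|'D_1 x al| <= r -> `|x (al + e)| <= M.
Proof.
move=> r0; pose B := `|a| + r + 2.
have cf : {within phase_box al (al + 1) B, continuous (uncurry3 f)}.
  by apply: continuous_subspaceT => z; exact: MB_continuous hf _.
have /ex_strict_bound_gt0[C C0 hC] :=
  compact_bounded (continuous_compact cf (@compact_phase_box al (al + 1) B)).
(* Up to time [e] the velocity changes by at most [e * C < 1] and stays below [r + 1]; the position
   moves by at most [r + 1] and stays below [B]. Both bounds are strict, as the bootstrap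
   requires. *)
pose e := Num.min 1 ((C + 1)^-1).
have C1 : 0 < C + 1 by rewrite addr_gt0.
have e0 : 0 < e by rewrite lt_min ltr01 invr_gt0.
have e1 : e <= 1 by rewrite ge_min lexx.
have eC : e * C < 1.
  apply: (@le_lt_trans _ _ ((C + 1)^-1 * C)).
    by rewrite ler_wpM2r ?(ltW C0)// ge_min lexx orbT.
  by rewrite ltr_pdivrMl// mulr1 ltrDl.
exists e => //; exists B => x hx xal dxal.
have na := normr_ge0 a.
(* One scalar function carries both bounds, so that a single bootstrap handles position and velocity
   together. *)
pose m (t : R) := Num.max (`|x t| - B) (`|'D_1 x t| - (r + 1)).
have cm (t : R) : {for t, continuous m}.
  apply/continuous_normP => ep ep0.
  have /continuous_normP/(_ _ ep0)[d1 d10 h1] := @sol_continuous _ t hx.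
  have /continuous_normP/(_ _ ep0)[d2 d20 h2] := @sol_derive_continuous _ t hx.
  exists (Num.min d1 d2); first by rewrite lt_min d10.
  move=> u; rewrite lt_min => /andP[/h1 k1 /h2 k2].
  apply: dist_max_lt; rewrite opprB addrA subrK.
    exact: le_lt_trans (ler_dist_dist _ _) k1.
  exact: le_lt_trans (ler_dist_dist _ _) k2.
have hm : forall t : R, al <= t <= al + e -> m t < 0.
  apply: continuity_bootstrap => //.
    by rewrite gt_max !subr_lt0 xal /B; apply/andP; split; lra.
  move=> t /andP[alt te] hs.
  have hs' (s : R) : al <= s <= t -> `|x s| <= B /\ `|'D_1 x s| <= r + 1.
    by move=> /hs; rewrite ge_max !subr_le0 => /andP.
  have k1 : `|x t - x al - (t - al) *: 0| <= (t - al) * (r + 1).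
    apply: mean_value_ineq_segment => // s sl; first by have [] := hx s.
    by rewrite subr0; have [] := hs' s sl.
  have k2 : `|'D_1 x t - 'D_1 x al - (t - al) *: 0| <= (t - al) * C.
    apply: (@mean_value_ineq_segment _ (fun s => 'D_1 x s)) => // s sl.
      by have [_ []] := hx s.
    rewrite subr0; have [_ [_ ->]] := hx s; have [x1 x2] := hs' s sl.
    apply: ltW; apply: hC; exists (s, x s, 'D_1 x s) => //; split; [split|] => //=.
      by case/andP: sl => s1 s2; rewrite in_itv /= s1 (le_trans s2)// (le_trans te)// lerD2l.
    by rewrite (le_trans x2)// /B; lra.
  rewrite !scaler0 !subr0 in k1 k2.
  have tal : t - al <= e by rewrite lerBlDl.
  have tal0 : 0 <= t - al by rewrite subr_ge0.
  have k3 : (t - al) * (r + 1) <= r + 1.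
    by rewrite ler_piMl ?addr_ge0// (le_trans tal).
  have k4 : (t - al) * C <= e * C by rewrite ler_wpM2r// ltW.
  have k5 : `|x t| <= `|x t - x al| + `|x al|.
    by rewrite -{1}(subrK (x al) (x t)) ler_normD.
  have k6 : `|'D_1 x t| <= `|'D_1 x t - 'D_1 x al| + `|'D_1 x al|.
    by rewrite -{1}(subrK ('D_1 x al) ('D_1 x t)) ler_normD.
  by rewrite xal in k1 k5; rewrite /m gt_max /B; apply/andP; split; lra.
have := hm (al + e); rewrite lexx lerDl (ltW e0) => /(_ isT).
by rewrite gt_max subr_lt0 => /andP[/ltW].
Qed.

End ODE.

(** * Integrals depending on a parameter *)

Section VectorIntegral.
Variables (R : realType) (n : nat).
Notation vec := 'rV[R]_n.
Notation mu := (@lebesgue_measure R).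
Implicit Types g h : R -> vec.

Definition cont g := forall t : R, {for t, continuous g}.

Definition vint g : vec := \row_i (\int[mu]_(s in `[0, 1]) (g s 0 i)).

Lemma continuous_coord g i t : cont g -> {for t, continuous (fun s => g s 0 i)}.
Proof.
move=> cg; apply: (@continuous_comp _ _ _ g (fun y : vec => y 0 i)); first exact: cg.
exact: coord_continuous.
Qed.

Lemma integrable_coord g i : cont g ->
  mu.-integrable `[0, 1] (EFin \o (fun s => g s 0 i)).
Proof.
move=> cg; apply: continuous_compact_integrable; first exact: segment_compact.
by apply: continuous_subspaceT => t; exact: continuous_coord.
Qed.

Lemma contB g h : cont g -> cont h -> cont (fun s => g s - h s).
Proof. by move=> cg ch t; apply: cvgB; [exact: cg|exact: ch]. Qed.

Lemma vintB g h : cont g -> cont h -> vint (fun s => g s - h s) = vint g - vint h.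
Proof.
move=> cg ch; apply/rowP => i; rewrite !mxE -RintegralB//; [|exact: integrable_coord..].
by apply: eq_Rintegral => s _; rewrite !mxE.
Qed.

Lemma vintZ (r : R) g : cont g -> vint (fun s => r *: g s) = r *: vint g.
Proof.
move=> cg; apply/rowP => i; rewrite !mxE -RintegralZl//; last exact: integrable_coord.
by apply: eq_Rintegral => s _; rewrite !mxE.
Qed.

Lemma vint_cst (c : vec) : vint (fun=> c) = c.
Proof.
apply/rowP => i; rewrite !mxE Rintegral_cst//= lebesgue_measure_itv /= lte01.
by rewrite oppr0 adde0 mulr1.
Qed.

Lemma vint_norm_le g (M : R) : cont g -> (forall s, 0 <= s <= 1 -> `|g s| <= M) -> `|vint g| <= M.
Proof.
move=> cg hM.
have M0 : 0 <= M by apply: le_trans (hM 0 _); rewrite ?lexx ?ler01.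
apply: rV_norm_le => // i; rewrite mxE.
have cM : cont (fun=> const_mx M) by move=> t; exact: continuous_cst_at.
have ai : mu.-integrable `[0, 1] (EFin \o (fun s => `|g s 0 i|)).
  apply: continuous_compact_integrable; first exact: segment_compact.
  apply: continuous_subspaceT => t; apply: (@continuous_comp _ _ _ (fun s => g s 0 i) Num.norm).
    exact: continuous_coord.
  exact: norm_continuous.
apply: (le_trans (le_normr_Rintegral _ (integrable_coord i cg))) => //.
apply: (@le_trans _ _ (\int[mu]_(s in `[0, 1]) (const_mx M : vec) 0 i)).
  apply: le_Rintegral => //.
    exact: (integrable_coord i cM).
  move=> s /=; rewrite in_itv /= => s01; rewrite mxE.
  by apply: (le_trans (coord_norm_le _ _)); exact: hM.
by have /rowP/(_ i) := vint_cst (const_mx M); rewrite !mxE => ->.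
Qed.

Lemma vint_FTC (G g : R -> vec) : cont g -> (forall s : R, is_derive s 1 G (g s)) ->
  vint g = G 1 - G 0.
Proof.
move=> cg dG; apply/rowP => i; rewrite !mxE.
have dGi (s : R) : is_derive s 1 (fun s => G s 0 i) (g s 0 i) by exact: is_derive_coord.
have ci t : {for t, continuous (fun s => G s 0 i)}.
  by apply: derivable_continuous1; have [] := dGi t.
rewrite /Rintegral (@continuous_FTC2 R (fun s => g s 0 i) (fun s => G s 0 i))//=.
- by apply: continuous_subspaceT => t; exact: continuous_coord.
- split.
  + by move=> s _; have [] := dGi s.
  + by apply: cvg_at_right_filter; exact: ci.
  + by apply: cvg_at_left_filter; exact: ci.
- by move=> s _; rewrite derive1E; have [_ ->] := dGi s.
Qed.

(** Compactness of the unit interval makes continuity in the parameter uniform in [s]; this is what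
    lets limits and derivatives pass under [vint]. *)
Lemma tube (X : normedModType R) (G : R * X -> vec) (x : X) (e : R) : 0 < e ->
  (forall s, {for (s, x), continuous G}) ->
  \forall y \near x, forall s, 0 <= s <= 1 -> `|G (s, y) - G (s, x)| <= e.
Proof.
move=> e0 cG; have /compact_near_coveringP c01 := @segment_compact R 0 1.
have : \forall y \near x, [set` `[(0 : R), 1]] `<=` [set s | `|G (s, y) - G (s, x)| <= e].
  apply: (c01 X (nbhs x) (fun y s => `|G (s, y) - G (s, x)| <= e)) => s0 _.
  have e20 : 0 < e / 2 by rewrite divr_gt0.
  have /continuous_normP/(_ _ e20)[d d0 hd] := cG s0.
  exists ([set s | `|s - s0| < d], [set y | `|y - x| < d]).
    split; last by apply/near_normP; exists d.
    by apply: (@near_normP R R s0 (fun s => `|s - s0| < d)).2; exists d.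
  move=> [s y] /= [sd yd].
  have h1 := hd (s, y); have h2 := hd (s, x).
  rewrite (_ : _ - _ = (G (s, y) - G (s0, x)) - (G (s, x) - G (s0, x))); last first.
    by rewrite opprB addrA subrK.
  rewrite (le_trans (ler_normB _ _))// (splitr e) lerD// ltW//.
    by apply: h1; rewrite prod_norm_lt /= yd sd.
  by apply: h2; rewrite prod_norm_lt /= subrr normr0 d0 sd.
by apply: filterS => y h s s01; apply: h; rewrite /= in_itv.
Qed.

Lemma cont_slice k (X : normedModType R) (U : set X) (G : R * X -> vec) x :
  MB k ([set: R] `*` U) G -> U x -> cont (fun s => G (s, x)).
Proof.
move=> hG Ux t; apply: (@continuous_comp _ _ _ (fun s : R => (s, x)) G).
  by apply: continuous_pair; [exact: continuous_id_at|exact: continuous_cst_at].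
by apply: MB_continuous hG _.
Qed.

Lemma continuous_vint k (X : normedModType R) (U : set X) (G : R * X -> vec) x :
  open U -> MB k ([set: R] `*` U) G -> U x ->
  {for x, continuous (fun y => vint (fun s => G (s, y)))}.
Proof.
move=> oU hG Ux; apply/continuous_normP => e e0.
have e20 : 0 < e / 2 by rewrite divr_gt0.
have cG (s : R) : {for (s, x), continuous G} by apply: MB_continuous hG _.
have /near_normP[d1 d10 hd1] := tube e20 cG.
have /near_normP[d2 d20 hd2] := open_near oU Ux.
exists (Num.min d1 d2); first by rewrite lt_min d10.
move=> y; rewrite lt_min => /andP[/hd1 h /hd2 Uy].
apply: (@le_lt_trans _ _ (e / 2)); last by rewrite ltr_pdivrMr// mulr_natr mulr2n ltrDl.
rewrite -vintB; [|exact: cont_slice hG _..].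
apply: vint_norm_le => //; exact: (contB (cont_slice hG Uy) (cont_slice hG Ux)).
Qed.

(** By [tube] the partial derivative [D] varies little, uniformly in [s], so the mean value
    inequality bounds the remainder of the integrand before integration. *)
Lemma is_derive_vint k (X : normedModType R) (U : set X) (G : R * X -> vec) x v :
  open U -> MB k.+1 ([set: R] `*` U) G -> U x ->
  is_derive x v (fun y => vint (fun s => G (s, y)))
    (vint (fun s => 'D_(0, v) G (s, x))).
Proof.
move=> oU hG Ux; apply/is_derive_normP => e e0.
pose D (z : R * X) := 'D_(0, v) G z.
have oTU : open ([set: R] `*` U) by apply: openX => //; exact: openT.
have cD (s : R) y : U y -> {for (s, y), continuous D}.
  move=> Uy; apply: (@continuous_comp _ _ _ (fun z => (z, (0, v)))
    (fun z : (R * X) * (R * X) => 'D_(z.2) G z.1)).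
    by apply: continuous_pair; [exact: continuous_id_at|exact: continuous_cst_at].
  exact: MB_derive_continuous hG _.
have cDs : cont (fun s => D (s, x)).
  move=> t; apply: (@continuous_comp _ _ _ (fun s : R => (s, x)) D).
    by apply: continuous_pair; [exact: continuous_id_at|exact: continuous_cst_at].
  exact: cD.
have /near_normP[d1 d10 hd1] := tube e0 (fun s => cD s x Ux).
have /near_normP[d2 d20 hd2] := open_near oU Ux.
pose K := `|v| + 1; have K0 : 0 < K by rewrite ltr_wpDl.
apply/near_normP; exists (Num.min d1 d2 / K); first by rewrite divr_gt0// lt_min d10.
move=> t; rewrite subr0 ltr_pdivlMr// => tK.
have near_s (s : R) : 0 <= s <= 1 -> `|x + s *: (t *: v) - x| < Num.min d1 d2.
  move=> /andP[s0 s1]; apply: le_lt_trans tK.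
  rewrite (_ : _ - x = t *: (s *: v)); last by lmod R.
  rewrite normrZ ler_wpM2l// normrZ ger0_norm//.
  by rewrite (@le_trans _ _ `|v|) ?ler_piMl// /K lerDl.
have Ut : U (x + t *: v).
  have := near_s 1; rewrite ler01 lexx scale1r lt_min => /(_ isT)/andP[_].
  exact: hd2.
have c1 := cont_slice hG Ut; have c2 := cont_slice hG Ux.
have c3 : cont (fun s => t *: D (s, x)).
  by move=> s; apply: continuous_comp; [exact: cDs|exact: scaler_continuous].
have c12 : cont (fun s => G (s, x + t *: v) - G (s, x)).
  exact: (contB c1 c2).
rewrite -[vint (fun s => 'D_(0, v) G (s, x))]/(vint (fun s => D (s, x))).
rewrite -(vintB c1 c2) -(vintZ t cDs) -(vintB c12 c3); apply: vint_norm_le.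
  exact: (contB c12 c3).
move=> s s01; rewrite /D.
have -> : (s, x + t *: v) = (s, x) + t *: (0, v).
  by rewrite -[RHS]/(s + t *: 0, x + t *: v) scaler0 addr0.
have pt (u : R) : (s, x) + u *: (t *: (0, v)) = (s, x + u *: (t *: v)).
  by rewrite -[LHS]/(s + u *: (t *: 0), x + u *: (t *: v)) !scaler0 addr0.
apply: mean_value_ineq_dir => u /near_s; rewrite lt_min pt => /andP[u1 u2].
  by apply: MB_derivable hG _; split=> //; exact: hd2.
rewrite derive_dirZ; last by apply: MB_derivable hG _; split=> //; exact: hd2.
by rewrite -scalerBr normrZ mulrC ler_wpM2r//; exact: hd1.
Qed.

(** The derivative is again a parameter integral, now with parameter [(x, v)]; hence the induction
    is over all parameter spaces. *)
Lemma MB_vint k (X : normedModType R) (U : set X) (G : R * X -> vec) : open U ->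
  MB k ([set: R] `*` U) G -> MB k U (fun x => vint (fun s => G (s, x))).
Proof.
elim: k X U G => [|k IH] X U G oU hG; first by move=> x Ux; exact: continuous_vint hG Ux.
split; first by move=> x Ux; exact: continuous_vint hG Ux.
split; first by move=> x v Ux; have [] := is_derive_vint v oU hG Ux.
have oUT : open (U `*` [set: X]) by exact: openXT.
have oTU : open ([set: R] `*` U) by apply: openX => //; exact: openT.
have oTUT : open ([set: R] `*` (U `*` [set: X])) by apply: openX => //; exact: openT.
apply: (MB_eq oUT (f := fun z : X * X => vint (fun s => 'D_(0, z.2) G (s, z.1)))).
  by move=> -[x v] [/= Ux _]; have [_ ->] := is_derive_vint v oU hG Ux.
apply: (IH _ _ (fun w : R * (X * X) => 'D_(0, w.2.2) G (w.1, w.2.1))) => //.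
have l1 : MB k ([set: R] `*` (U `*` [set: X])) fst.
  by apply: MB_linear; exact: continuous_linear_fst.
have l2 : MB k ([set: R] `*` (U `*` [set: X])) snd.
  by apply: MB_linear; exact: continuous_linear_snd.
apply: (MB_comp (f := fun w : R * (X * X) => ((w.1, w.2.1), (0, w.2.2))) oTUT
  (openXT oTU) _ _ (MB_derive hG)); first by move=> [s [x v]] [_ [/= Ux _]].
apply: MB_pair => //; apply: MB_pair => //; [exact: MB_fst|exact: MB_cst|exact: MB_snd].
Qed.

End VectorIntegral.

(** Works on the syntax of explicit maps. The cases [fst], [snd] and [pair c] cover eta-reduced
    forms, and products of reals are recognised when written with [*:]. *)
Ltac mb_step oU :=
  lazymatch goal with
  | |- MB _ _ (fun x => x) => refine (MB_id _ _)
  | |- MB _ _ fst => exact: (MB_linear _ _ (continuous_linear_fst _ _))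
  | |- MB _ _ snd => exact: (MB_linear _ _ (continuous_linear_snd _ _))
  | |- MB _ _ (pair ?c) => refine (MB_pair oU (MB_cst _ _ c) (MB_id _ _))
  | |- MB _ _ (fun x => (_, _)) => refine (MB_pair oU _ _)
  | |- MB _ _ (fun x => fst _) => refine (MB_fst oU _)
  | |- MB _ _ (fun x => snd _) => refine (MB_snd oU _)
  | |- MB _ _ (fun x => @GRing.add _ _ (@GRing.opp _ _)) => refine (MB_sub oU _ _)
  | |- MB _ _ (fun x => @GRing.add _ _ _) => refine (MB_add oU _ _)
  | |- MB _ _ (fun x => @GRing.scale _ _ _ _) => refine (MB_scale oU _ _)
  | |- MB _ _ (fun _ => ?c) => refine (MB_cst _ _ c)
  end.
Ltac mb oU := repeat (mb_step oU).

(** * Passing to the limit at a diagonal point *)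

Section Limits.
Variable R : realType.
Implicit Types V W : normedModType R.

Lemma MB_derive_dir k V W (U : set V) (f : V -> W) (v : V) : open U ->
  MB k.+1 U f -> MB k U (fun x => 'D_v f x).
Proof.
move=> oU hf.
have oUT : open (U `*` [set: V]) by exact: openXT.
apply: (MB_comp (f := fun x => (x, v)) oU oUT _ _ (MB_derive hf)) => //.
by mb oU.
Qed.

Lemma punctured_eq W (p q : R -> W) (c : R) :
  {for c, continuous p} -> {for c, continuous q} ->
  (forall d, d <> c -> p d = q d) -> p c = q c.
Proof.
move=> /continuous_normP cp /continuous_normP cq pq.
apply/eqP; rewrite -subr_eq0 -normr_le0; apply/ler_addgt0Pr => e e0.
have e20 : 0 < e / 2 by rewrite divr_gt0.
have [d1 d10 h1] := cp _ e20; have [d2 d20 h2] := cq _ e20.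
pose d := Num.min d1 d2; have d0 : 0 < d by rewrite lt_min d10.
have hd : `|c + d / 2 - c| < d.
  by rewrite addrAC subrr add0r gtr0_norm ?divr_gt0// ltr_pdivrMr// mulr_natr mulr2n ltrDl.
have nc : c + d / 2 <> c.
  by move/eqP; rewrite -subr_eq0 addrAC subrr add0r gt_eqF// divr_gt0.
move: hd; rewrite lt_min => /andP[/h1 k1 /h2 k2]; rewrite (pq _ nc) in k1.
rewrite add0r (_ : p c - q c = (q (c + d / 2) - q c) - (q (c + d / 2) - p c)); last by lmod R.
by rewrite (le_trans (ler_normB _ _))// (splitr e) lerD// ltW.
Qed.

(** Setting the difference quotient equal to [w] at [c] makes it continuous there, so the identity
    for [d <> c] extends to [d = c]. This is how condition (i) is carried to the diagonal. *)
Lemma quotient_limit V W (x : R -> V) (w : V) (p : R * V -> W) (c : R) (l : W) :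
  is_derive c 1 x w -> {for (c, w), continuous p} ->
  (forall d, d <> c -> p (d, (d - c)^-1 *: (x d - x c)) = l) -> p (c, w) = l.
Proof.
move=> dx cp hl.
pose q (d : R) := if d == c then w else (d - c)^-1 *: (x d - x c).
have cq : {for c, continuous q}.
  apply/continuous_normP => e e0.
  have e20 : 0 < e / 2 by rewrite divr_gt0.
  have /is_derive_normP/(_ _ e20)/near_normP[d d0 hd] := dx.
  exists d => // y yd; rewrite /q eqxx; case: eqVneq => [_|yc]; first by rewrite subrr normr0.
  have yc0 : y - c != 0 by rewrite subr_eq0.
  have := hd (y - c); rewrite subr0 => /(_ yd).
  rewrite [(y - c) *: 1]mulr1 addrCA subrr addr0 => h.
  rewrite (_ : _ - w = (y - c)^-1 *: (x y - x c - (y - c) *: w)); last by lmod R.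
  rewrite normrZ normfV ltr_pdivrMl ?normr_gt0//; apply: (le_lt_trans h).
  rewrite mulrC ltr_pM2l ?normr_gt0//.
  by rewrite ltr_pdivrMr// mulr_natr mulr2n ltrDl.
have qc : q c = w by rewrite /q eqxx.
have := @punctured_eq W (fun d => p (d, q d)) (fun=> l) c.
rewrite /= qc; apply.
- apply: (@continuous_comp _ _ _ (fun d => (d, q d)) p).
    by apply: continuous_pair; [exact: continuous_id_at|].
  by rewrite qc.
- exact: continuous_cst_at.
- by move=> d dc; rewrite /q; case: eqVneq dc => // _; exact: hl.
Qed.

Lemma time_derive_on n (U : set (R * R * R * 'rV[R]_n * 'rV[R]_n)) G
    (tau al be : R) (a v : 'rV[R]_n) :
  MB 1 U G -> U (tau, al, be, a, v) ->
  is_derive tau 1 (fun t => G (t, al, be, a, v))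
    ('D_(1, 0, 0, 0, 0) G (tau, al, be, a, v) : 'rV[R]_n).
Proof.
move=> hG Uz; set e1 := (1, 0, 0, 0, 0).
have h : is_derive (tau, al, be, a, v) e1 G ('D_e1 G (tau, al, be, a, v)).
  by apply: derivableP; exact: MB_derivable hG _.
apply/is_derive_normP => e e0; have /is_derive_normP/(_ e e0) := h; apply: filterS => t.
rewrite [t *: 1]mulr1 (_ : (tau, al, be, a, v) + t *: e1 = (tau + t, al, be, a, v))//.
rewrite -[LHS]/(tau + t * 1, al + t * 0, be + t * 0, a + t *: 0, v + t *: 0).
by rewrite mulr1 mulr0 !scaler0 !addr0.
Qed.

End Limits.

(** * From the extension to the equation *)

Section Sufficiency.
Variables (R : realType) (n : nat).
Notation vec := 'rV[R]_n.
Notation X5 := (R * R * R * vec * vec)%type.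
Variable F : R -> R -> R -> vec -> vec -> vec.
Hypothesis F1 : forall (tau gamma delta alpha beta : R) (a b : vec),
  alpha <> beta -> gamma <> delta ->
  F tau alpha beta a b =
  F tau gamma delta (F gamma alpha beta a b) (F delta alpha beta a b).
Hypothesis F2 : forall (alpha beta : R) (a b : vec), alpha <> beta ->
  F alpha alpha beta a b = a /\ F beta alpha beta a b = b.
Variable S : X5 -> vec.
Hypothesis hS : forall k, MB k [set: X5] S.
Hypothesis SF : forall (tau alpha beta : R) (a v : vec), alpha <> beta ->
  S (tau, alpha, beta, a, v) = F tau alpha beta a (a + (beta - alpha) *: v).

Let e1 : X5 := (1, 0, 0, 0, 0).
Let e3 : X5 := (0, 0, 1, 0, 0).
Let S1 (z : X5) := 'D_e1 S z.
Let S2 (z : X5) := 'D_e1 S1 z.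

Let hS1 k : MB k [set: X5] S1.
Proof. by apply: MB_derive_dir => //; exact: openT. Qed.

Let hS2 k : MB k [set: X5] S2.
Proof. by apply: MB_derive_dir => //; exact: openT. Qed.

Definition ode_of_extension (t : R) (a v : vec) : vec := S2 (t, t, t, a, v).
Local Notation f := ode_of_extension.
Local Notation sol := (complete_solution f).

Lemma smooth_ode_of_extension k : MB k [set: R * vec * vec] (uncurry3 f).
Proof.
have oT := @openT (R * vec * vec)%type.
apply: (MB_compT (f := fun z : R * vec * vec => (z.1.1, z.1.1, z.1.1, z.1.2, z.2)) oT _ (hS2 k)).
by mb oT.
Qed.

Lemma time_derive (G : X5 -> vec) (tau al be : R) (a v : vec) :
  MB 1 [set: X5] G ->
  is_derive tau 1 (fun t => G (t, al, be, a, v)) ('D_e1 G (tau, al, be, a, v)).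
Proof. by move=> hG; exact: (time_derive_on hG I). Qed.

Lemma continuous_param (W V : normedModType R) (G : X5 -> W) (g : V -> X5) (x : V) :
  MB 1 [set: X5] G -> MB 1 [set: V] g -> {for x, continuous (fun y => G (g y))}.
Proof.
move=> hG hg; apply: (@continuous_comp _ _ _ g G); first exact: (MB_continuous hg).
exact: (MB_continuous hG).
Qed.

Let oTR : open [set: R]. Proof. exact: openT. Qed.

Lemma extension_offdiag (tau al be : R) (a b : vec) : al <> be ->
  S (tau, al, be, a, (be - al)^-1 *: (b - a)) = F tau al be a b.
Proof.
move=> ab; rewrite SF// scalerA divff ?scale1r; last first.
  by rewrite subr_eq0; apply/eqP => h; exact: ab.
by rewrite addrC subrK.
Qed.

Section OffDiagonalSolution.
Variables (al be : R) (a b : vec).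
Hypothesis ab : al <> be.
Let v := (be - al)^-1 *: (b - a).
Let x (t : R) := S (t, al, be, a, v).

Lemma offdiag_solF t : x t = F t al be a b.
Proof. exact: extension_offdiag. Qed.

Let dx (t : R) : is_derive t 1 x (S1 (t, al, be, a, v)).
Proof. exact: time_derive. Qed.

Lemma offdiag_sol_eq (t c : R) : x t = S (t, c, c, x c, 'D_1 x c).
Proof.
apply/esym; apply: (quotient_limit (x := x)
  (p := fun z : R * vec => S (t, c, z.1, x c, z.2)) (derivableP _)).
- by have [] := dx c.
- apply: continuous_param => //.
  by have oT := @openT (R * vec)%type; mb oT.
(* For [d <> c] the value is [F t c d (x c) (x d)], which is [x t] by condition (i). *)
- move=> d dc; rewrite extension_offdiag; last by move=> h; exact: dc.
  by rewrite !offdiag_solF -F1// => h; exact: dc.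
Qed.

Lemma offdiag_sol : sol x.
Proof.
move=> t.
(* With the base point frozen at [t], two derivatives in [s] evaluated at [s = t] give exactly the
   value of [f]. *)
have xt : x = fun s => S (s, t, t, x t, 'D_1 x t).
  by apply/funext => s; exact: offdiag_sol_eq.
have Dx (s : R) : 'D_1 x s = S1 (s, t, t, x t, 'D_1 x t).
  by rewrite {1}xt; have [_ ->] := time_derive s t t (x t) ('D_1 x t) (hS 1).
have DDx : is_derive t 1 (fun s => 'D_1 x s) (S2 (t, t, t, x t, 'D_1 x t)).
  rewrite (_ : (fun s => 'D_1 x s) = fun s => S1 (s, t, t, x t, 'D_1 x t)).
    exact: time_derive.
  by apply/funext => s; exact: Dx.
split; first by have [] := dx t.
have [h1 h2] := DDx; split; [exact: h1|exact: h2].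
Qed.

End OffDiagonalSolution.

Lemma diag_sol_offdiag (g d : R) (a v : vec) : g <> d -> sol (fun t => S (t, g, d, a, v)).
Proof.
move=> gd; have := @offdiag_sol g d a (a + (d - g) *: v) gd.
rewrite (_ : (d - g)^-1 *: _ = v)//.
rewrite addrAC subrr add0r scalerA mulVf ?scale1r// subr_eq0.
by apply/eqP => h; exact: gd.
Qed.

(** The equation holds along [S (., g, d, a, v)] for every [d <> g], and at each time both of its
    sides are continuous in [d]. *)
Lemma diag_sol (g : R) (a v : vec) : sol (fun t => S (t, g, g, a, v)).
Proof.
have D1 (d t : R) : 'D_1 (fun t => S (t, g, d, a, v)) t = S1 (t, g, d, a, v).
  by have [_ ->] := time_derive t g d a v (hS 1).
have D1f (d : R) : (fun s => 'D_1 (fun t => S (t, g, d, a, v)) s) =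
    fun s => S1 (s, g, d, a, v) by apply/funext => s; exact: D1.
have D2 (d t : R) : is_derive t 1 (fun s => 'D_1 (fun t => S (t, g, d, a, v)) s)
    (S2 (t, g, d, a, v)).
  by rewrite D1f; exact: time_derive.
move=> t; split; first by have [] := time_derive t g g a v (hS 1).
split; first by have [] := D2 g t.
have [_ ->] := D2 g t; rewrite D1.
apply: (@punctured_eq _ _ (fun d => S2 (t, g, d, a, v))
  (fun d => f t (S (t, g, d, a, v)) (S1 (t, g, d, a, v)))).
- by apply: (continuous_param (g := fun d => (t, g, d, a, v)) (hS2 1)); mb oTR.
- apply: (continuous_param (g := fun d : R =>
    (t, t, t, S (t, g, d, a, v), S1 (t, g, d, a, v))) (hS2 1)).
  mb oTR.
    by apply: (MB_compT (f := fun d : R => (t, g, d, a, v)) oTR _ (hS 1)); mb oTR.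
  by apply: (MB_compT (f := fun d : R => (t, g, d, a, v)) oTR _ (hS1 1)); mb oTR.
- move=> d dg; have gd : g <> d by move=> h; exact: dg.
  have [_ [_]] := diag_sol_offdiag a v gd t.
  by have [_ ->] := D2 d t; rewrite D1.
Qed.

Lemma diag_sol_value (g : R) (a v : vec) : S (g, g, g, a, v) = a.
Proof.
apply: (@punctured_eq _ _ (fun d => S (g, g, d, a, v)) (fun=> a)).
- by apply: continuous_param => //; mb oTR.
- exact: continuous_cst_at.
- move=> d dg; have gd : g <> d by move=> h; exact: dg.
  by rewrite SF//; have [] := F2 a (a + (d - g) *: v) gd.
Qed.

(** Along [d -> (d, g, d)] the end condition in (ii) makes [S] equal to [a + (d - g) *: v], and
    along [d -> (g, g, d)] the initial condition makes it constant. The difference of the two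
    derivatives is the derivative in the first variable. *)
Lemma diag_sol_derive (g : R) (a v : vec) : S1 (g, g, g, a, v) = v.
Proof.
have openX5 : open [set: X5] by exact: openT.
have d3 : is_derive g 1 (fun d : R => (g, g, d, a, v)) e3.
  by do !apply: is_derive_pair.
have d13 : is_derive g 1 (fun d : R => (d, g, d, a, v)) (e1 + e3).
  rewrite -[e1 + e3]/(1 + 0, 0 + 0, 0 + 1, 0 + 0, 0 + 0) !addr0 add0r.
  by do !apply: is_derive_pair.
have k3 := is_derive_compMB openX5 (hS 1) (I : [set: X5] (g, g, g, a, v)) d3.
have k13 := is_derive_compMB openX5 (hS 1) (I : [set: X5] (g, g, g, a, v)) d13.
have E3 : (fun d : R => S (g, g, d, a, v)) = fun=> a.
  apply/funext => d; have [->|/eqP dg] := eqVneq d g; first exact: diag_sol_value.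
  have gd : g <> d by move=> h; exact: dg.
  by rewrite SF//; have [] := F2 a (a + (d - g) *: v) gd.
have E13 : (fun d : R => S (d, g, d, a, v)) = fun d => a + (d - g) *: v.
  apply/funext => d; have [->|/eqP dg] := eqVneq d g.
    by rewrite diag_sol_value subrr scale0r addr0.
  have gd : g <> d by move=> h; exact: dg.
  by rewrite SF//; have [] := F2 a (a + (d - g) *: v) gd.
rewrite E3 in k3; rewrite E13 in k13.
have z3 : 'D_e3 S (g, g, g, a, v) = 0.
  by case: k3 => _ <-; rewrite derive_cst.
have z13 : 'D_(e1 + e3) S (g, g, g, a, v) = v.
  case: k13 => _ <-.
  have [_ //] : is_derive g 1 (fun d : R => a + (d - g) *: v) v.
  apply/is_derive_normP => e e0; near=> t.
  rewrite (_ : _ - _ - _ = 0) ?normr0 ?mulr_ge0// ?ltW//.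
  by rewrite [t *: 1]mulr1; lmod R.
by move: z13; rewrite (derive_dirD _ _ openX5 (hS 1) (I : [set: X5] (g, g, g, a, v))) z3 addr0.
Unshelve. all: by end_near. Qed.

Lemma sol_diag y (g t : R) : sol y -> y t = S (t, g, g, y g, 'D_1 y g).
Proof.
move=> hy; have E := sol_unique (smooth_ode_of_extension 1) hy (diag_sol g (y g) ('D_1 y g)).
rewrite {1}(E g)//; first by rewrite diag_sol_value.
have [_ ->] := time_derive g g g (y g) ('D_1 y g) (hS 1).
by rewrite -[RHS]/(S1 (g, g, g, y g, 'D_1 y g)) diag_sol_derive.
Qed.

(** Condition (i) concerns values of [F], whereas an arbitrary solution is known as
    [S (., al, al, a, v)]. The identity holds for the nearby [S (., al, d, a, v)] with [d <> al],
    and [d] tends to [al]. *)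
Lemma dependence_of_extension : dependence F f.
Proof.
move=> al be t y ab hy; set a := y al; set v := 'D_1 y al.
have -> : y t = S (t, al, al, a, v) by exact: sol_diag.
rewrite -extension_offdiag// (_ : y be = S (be, al, al, a, v)); last exact: sol_diag.
apply/esym; apply: (@punctured_eq _ _ (fun d => S (t, al, d, a, v))
  (fun d => S (t, al, be, a, (be - al)^-1 *: (S (be, al, d, a, v) - a)))).
- by apply: continuous_param => //; mb oTR.
- apply: (@continuous_param _ _ S) => //; mb oTR.
  by apply: (MB_compT (f := fun d : R => (be, al, d, a, v)) oTR _ (hS 1)); mb oTR.
- move=> d da; have ad : al <> d by move=> h; exact: da.
  rewrite extension_offdiag// !SF// (F1 _ _ _ ad ab).
  by have [-> _] := F2 a (a + (d - al) *: v) ad.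
Qed.

Lemma N_solvable_of_extension : N_solvable f.
Proof.
move=> al be a b ab.
exists (fun t => S (t, al, be, a, (be - al)^-1 *: (b - a))); split.
  split; first exact: offdiag_sol.
  by rewrite !extension_offdiag//; exact: F2.
move=> y [hy [ya yb]]; apply/funext => t.
by rewrite extension_offdiag// -ya -yb; exact: dependence_of_extension.
Qed.

Lemma open_offdiag : open (@offdiag R n).
Proof.
rewrite (_ : @offdiag R n = [set z | z.1.1.2 - z.1.1.1.2 != 0]); last first.
  apply/seteqP; split=> z /=; first by move/eqP; rewrite subr_eq0 eq_sym.
  by rewrite subr_eq0 eq_sym => /eqP.
have oT := @openT X5.
apply: (@open_comp _ _ (fun z : X5 => z.1.1.2 - z.1.1.1.2) [set r : R | r != 0]).
  move=> z _; have h : MB 0 [set: X5] (fun z : X5 => z.1.1.2 - z.1.1.1.2) by mb oT.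
  exact: (MB_continuous h).
exact: open_neq0.
Qed.

Lemma smooth_offdiag_of_extension : smooth_on (@offdiag R n) (uncurry5 F).
Proof.
move=> k; have oO := open_offdiag; apply: MB_Ck_on => //.
pose g (z : X5) := S (z.1.1.1.1, z.1.1.1.2, z.1.1.2, z.1.2,
  (z.1.1.2 - z.1.1.1.2)^-1 *: (z.2 - z.1.2)).
apply: (@MB_eq _ k _ _ (@offdiag R n) g (uncurry5 F) oO).
  by move=> z zO; exact: extension_offdiag.
apply: (MB_compT (f := fun z : X5 => (z.1.1.1.1, z.1.1.1.2, z.1.1.2, z.1.2,
   (z.1.1.2 - z.1.1.1.2)^-1 *: (z.2 - z.1.2))) oO _ (hS k)).
mb oO; apply: MB_inv => //; last by mb oO.
by move=> z zO; rewrite subr_eq0 eq_sym; apply/eqP.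
Qed.

End Sufficiency.

(** * From the equation to the extension *)

(** Bounds a norm by its square without extracting a root. *)
Lemma le_sqr_succ (R : realType) (u s : R) : u ^+ 2 <= s -> u <= s + 1.
Proof. by move=> h; have := sqr_ge0 (u - 1); rewrite expr2 in h *; nra. Qed.

Section Necessity.
Variables (R : realType) (n : nat).
Notation vec := 'rV[R]_n.
Notation X5 := (R * R * R * vec * vec)%type.
Notation P4 := (R * R * vec * vec)%type.
Variable F : R -> R -> R -> vec -> vec -> vec.
Variable f : R -> vec -> vec -> vec.
Hypothesis hf : MB 1 [set: R * vec * vec] (uncurry3 f).
Hypothesis Nf : N_solvable f.
Hypothesis dF : dependence F f.
Hypothesis hF : forall k, MB k (@offdiag R n) (uncurry5 F).
Notation sol := (complete_solution f).

Let G : X5 -> vec := uncurry5 F.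
Let G1 (z : X5) : vec := 'D_(1, 0, 0, 0, 0) G z.

Lemma MB_time_derive k : MB k (@offdiag R n) G1.
Proof.
exact: (@MB_derive_dir R k X5 vec (@offdiag R n) G (1, 0, 0, 0, 0) (@open_offdiag R n) (hF k.+1)).
Qed.

Lemma sol_eq_dependence x (al be : R) : sol x -> al <> be ->
  x = fun t => F t al be (x al) (x be).
Proof. by move=> hx ab; apply/funext => t; rewrite dF. Qed.

Lemma dependence_sol (al be : R) (a b : vec) : al <> be ->
  [/\ sol (fun t => F t al be a b), F al al be a b = a & F be al be a b = b].
Proof.
move=> ab; have [x [[hx [<- <-]] _]] := Nf a b ab.
by rewrite -(sol_eq_dependence hx ab) !dF.
Qed.

Lemma dependence_consistent (tau gamma delta alpha beta : R) (a b : vec) :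
  alpha <> beta -> gamma <> delta ->
  F tau alpha beta a b =
  F tau gamma delta (F gamma alpha beta a b) (F delta alpha beta a b).
Proof.
move=> ab gd; have [hx _ _] := dependence_sol a b ab.
by have /(congr1 (fun x => x tau)) := sol_eq_dependence hx gd.
Qed.

Lemma dependence_derive (t al be : R) (a b : vec) : al <> be ->
  is_derive t 1 (fun s => F s al be a b) (G1 (t, al, be, a, b)).
Proof. by move=> ab; exact: (time_derive_on (hF 1)). Qed.

(** * The initial velocity as a function of the end value *)

Section InitialVelocity.
Variables (al de : R) (a c w : vec).
Hypothesis ald : al < de.

Let neq : al <> de. Proof. by apply/eqP; rewrite lt_eqF. Qed.

(* The stability estimate for the flow bounds the variation of the end value by that of
   the initial velocity, which makes the differential of the latter injective. *)
Lemma initial_velocity_injective :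
  is_derive (0 : R) 1 (fun t : R => G1 (al, al, de, a, c + t *: w)) 0 -> w = 0.
Proof.
move=> dG.
pose path (z : R * R) : X5 := (z.1, al, de, a, c + z.2 *: w).
have oRR : open [set: R * R] by exact: openT.
have mpath : MB 0 [set: R * R] path by rewrite /path; mb oRR.
have cK : compact ([set` `[al, de]%R] `*` [set` `[(-1 : R), 1]%R] : set (R * R)).
  by apply: compact_setX; exact: segment_compact.
(* One box must contain all the solutions with [t] between [-1] and [1], so that a single constant
   [K] serves along the whole path. *)
have bounded (H : X5 -> vec) : MB 0 (@offdiag R n) H -> exists2 B : R, 0 < B &
    forall s t : R, al <= s <= de -> -1 <= t <= 1 -> `|H (s, al, de, a, c + t *: w)| <= B.
  move=> hH.
  have cH : {within [set` `[al, de]%R] `*` [set` `[(-1 : R), 1]%R],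
      continuous (fun z => H (path z))}.
    apply: continuous_subspaceT => z.
    apply: (@continuous_comp _ _ _ path H); first exact: (MB_continuous mpath).
    exact: (MB_continuous hH).
  have /ex_strict_bound_gt0[B B0 hB] := compact_bounded (continuous_compact cH cK).
  exists B => // s t sl tl; apply: ltW; apply: hB; exists (s, t); last by [].
  by split; rewrite /= in_itv.
have [B1 B10 hB1] := bounded _ (hF 0).
have [B2 B20 hB2] := bounded _ (MB_time_derive 0).
have [K K0 hK] := flow_stability hf al de (B1 + B2).
pose y (t s : R) := F s al de a (c + t *: w).
have ysol t : sol (y t) by have [] := dependence_sol a (c + t *: w) neq.
have yD t s : 'D_1 (y t) s = G1 (s, al, de, a, c + t *: w).
  by have [_ ->] := dependence_derive s a (c + t *: w) neq.
have adeal : al <= al <= de by rewrite lexx ltW.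
have adede : al <= de <= de by rewrite lexx ltW.
have key (t : R) : -1 <= t <= 1 -> t ^+ 2 * sqn w <=
    sqn (G1 (al, al, de, a, c + t *: w) - G1 (al, al, de, a, c)) * K.
  move=> t1.
  have := hK (y t) (y 0) (ysol t) (ysol 0) _ al de adeal adede.
  have yal u : y u al = a by have [] := dependence_sol a (c + u *: w) neq.
  have yde u : y u de = c + u *: w by have [] := dependence_sol a (c + u *: w) neq.
  rewrite !yal !yde !yD scale0r addr0 subrr.
  have -> : sqn (0 : vec) = 0 by rewrite /sqn big1// => i _; rewrite mxE expr0n.
  rewrite add0r (_ : c + t *: w - c = t *: w); last by lmod R.
  have -> : sqn (t *: w) = t ^+ 2 * sqn w.
    by rewrite /sqn mulr_sumr; apply: eq_bigr => i _; rewrite mxE exprMn.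
  move=> h; apply: le_trans (h _); first by rewrite lerDl sqn_ge0.
  move=> s sl; rewrite !yD.
  have k1 := hB1 s t sl t1; have k2 := hB2 s t sl t1.
  have z1 : -1 <= (0 : R) <= 1 by rewrite lerN10 ler01.
  have k3 := hB1 s 0 sl z1; have k4 := hB2 s 0 sl z1.
  by split; [apply: (le_trans k1)|apply: (le_trans k2)|apply: (le_trans k3)|
    apply: (le_trans k4)]; rewrite ?lerDl ?lerDr ltW.
apply: sqn_eq0; apply/ler_addgt0Pr => e e0; rewrite add0r.
(* The final bound is [n * K * eta ^ 2]; with [eta <= 1] and [eta <= e / m] it is at most [e]. The
   summand [1] keeps [m] positive. *)
pose m : R := n%:R * K + 1; have m0 : 0 < m by rewrite ltr_wpDl// mulr_ge0// ltW.
pose eta := Num.min 1 (e / m).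
have eta0 : 0 < eta by rewrite lt_min ltr01 divr_gt0.
have /is_derive_normP/(_ _ eta0)/near_normP[d d0 hd] := dG.
pose t := Num.min 1 (d / 2).
have t0 : 0 < t by rewrite lt_min ltr01 divr_gt0.
have t1 : -1 <= t <= 1.
  by rewrite (le_trans _ (ltW t0)) ?lerN10//= ge_min lexx.
have := hd t; rewrite subr0 gtr0_norm// => /(_ _).
have td : t < d.
  by rewrite gt_min; apply/orP; right; rewrite ltr_pdivrMr// mulr_natr mulr2n ltrDl.
move=> /(_ td); rewrite [t *: 1]mulr1 add0r scale0r addr0 scaler0 subr0 => h.
have := key t t1.
set D := G1 _ - G1 _ in h *.
move=> k1; have k2 := sqn_le_sqr_norm D.
have k3 : `|D| ^+ 2 <= (eta * t) ^+ 2 by rewrite lerXn2r ?nnegrE// mulr_ge0 ?ltW.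
have k4 : t ^+ 2 * sqn w <= t ^+ 2 * (n%:R * K * eta ^+ 2).
  apply: (le_trans k1).
  apply: (@le_trans _ _ (n%:R * (eta * t) ^+ 2 * K)).
    by rewrite ler_wpM2r ?(ltW K0)// (le_trans k2)// ler_wpM2l.
  by rewrite exprMn le_eqVlt; apply/orP; left; apply/eqP; ring.
rewrite ler_pM2l ?exprn_gt0// in k4; apply: (le_trans k4).
apply: (@le_trans _ _ (m * eta)).
  have e1 : eta ^+ 2 <= eta by rewrite expr2 ler_piMl ?(ltW eta0)// ge_min lexx.
  apply: (@le_trans _ _ (n%:R * K * eta)).
    by rewrite ler_wpM2l// mulr_ge0// ltW.
  by rewrite ler_wpM2r ?(ltW eta0)// /m lerDl.
by rewrite mulrC -ler_pdivlMr// ge_min lexx orbT.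
Qed.

End InitialVelocity.

Section VelocityMap.
Variables (al de : R) (a : vec).
Hypothesis ald : al < de.
Let neq : al <> de. Proof. by apply/eqP; rewrite lt_eqF. Qed.
Let V (c : vec) := G1 (al, al, de, a, c).

Lemma MB_velocity k : MB k [set: vec] V.
Proof.
have oT : open [set: vec] by exact: openT.
apply: (MB_comp (f := fun c => (al, al, de, a, c)) oT (@open_offdiag R n) _ _ (MB_time_derive k)).
  by move=> c _; exact: neq.
by mb oT.
Qed.

Lemma velocity_injective c w : 'D_w V c = 0 -> w = 0.
Proof.
move=> h; apply: (@initial_velocity_injective al de a c w ald).
have k : is_derive (c + 0 *: w) w V 0.
  by rewrite scale0r addr0 -h; apply: derivableP; exact: MB_derivable (MB_velocity 1) _.
exact: (is_derive_shiftP V c w 0 0).1 k.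
Qed.

Lemma velocity_surjective c z : exists w, 'D_w V c = z.
Proof.
apply: linear_injective_surjective; last exact: velocity_injective.
exact: (derive_continuous_linear (@openT vec) (MB_velocity 1) (I : [set: vec] c)).1.
Qed.

End VelocityMap.

Lemma initial_value_existence (al : R) (a v : vec) :
  exists x, [/\ sol x, x al = a & 'D_1 x al = v].
Proof.
have al1 : al <> al + 1 by apply/eqP; rewrite lt_eqF// ltrDl.
(* The reference solution comes before [e]: the time [e] depends on [r], and [r] on the reference
   velocity [v0]. Its end value [0] is arbitrary. *)
have [hx0 x0a _] := dependence_sol a 0 al1.
set x0 := fun t => F t al (al + 1) a 0 in hx0.
pose v0 := 'D_1 x0 al.
(* Any initial velocity that is at least as close to [v] as [v0], measured by [sqn], has norm at
   most [r]. *)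
pose r := `|v| + sqn (v0 - v) + 1.
have r0 : 0 <= r by rewrite !addr_ge0 ?sqn_ge0.
have [e e0 [M hM]] := sol_apriori hf al a r0.
have ald : al < al + e by rewrite ltrDl.
have neq : al <> al + e by apply/eqP; rewrite lt_eqF.
pose c0 := x0 (al + e).
pose V c := G1 (al, al, al + e, a, c).
have VE c : 'D_1 (fun t => F t al (al + e) a c) al = V c.
  by have [_ ->] := dependence_derive al a c neq.
have Vc0 : V c0 = v0.
  by rewrite -VE /v0 [in RHS](sol_eq_dependence hx0 neq) (x0a : x0 al = a).
(* At distance [rho] from [c0] an end value has norm larger than [M], so by the a priori bound its
   initial velocity exceeds [r]. *)
pose rho := `|M| + `|c0| + 1.
have rho0 : 0 < rho by rewrite ltr_wpDl// addr_ge0.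
have oT : open [set: vec] by exact: openT.
have hV k := MB_velocity a ald k.
have hg k : MB k [set: vec] (fun c => V c - v).
  by apply: MB_sub => //; exact: MB_cst.
have dg c w : 'D_w (fun c => V c - v) c = 'D_w V c.
  rewrite deriveB ?derive_cst ?subr0//; first exact: MB_derivable (hV 1) _.
have [||||c _ /eqP] := @interior_min_zero R n (fun c => V c - v) c0 rho rho0.
- by move=> c _; exact: (MB_continuous (hg 0)).
- by move=> c w _; exact: (MB_derivable (hg 1)).
- move=> c z _; have [w Dw] := velocity_surjective a ald c z.
  by exists w; rewrite dg.
- move=> c cr; rewrite Vc0 ltNge; apply/negP => h.
  have h1 := le_trans (sqr_norm_le_sqn _) h.
  have h2 : `|V c - v| <= sqn (v0 - v) + 1.
    exact: le_sqr_succ.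
  have h3 : `|V c| <= r.
    rewrite -(subrK v (V c)) (le_trans (ler_normD _ _))// /r.
    by rewrite addrC -addrA lerD2l.
  have [hx xa xb] := dependence_sol a c neq.
  have := hM _ hx xa; rewrite VE xb => /(_ h3) cM.
  have := ler_normB c c0; rewrite cr /rho addrAC lerD2r.
  by move=> /le_trans/(_ cM)/le_trans/(_ (ler_norm M)); rewrite gerDl ler10.
rewrite subr_eq0 => /eqP Vc.
have [hx xa xb] := dependence_sol a c neq.
by exists (fun t => F t al (al + e) a c); split=> //; rewrite VE.
Qed.

(** The vector [v] is the mean velocity between [al] and [be], or the initial velocity when they
    coincide. With both cases in one predicate the extension has a single definition. *)
Definition two_point_data (al be : R) (a v : vec) (x : R -> vec) :=
  [/\ sol x, x al = a & if al == be then 'D_1 x al = v else x be = a + (be - al) *: v].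

Lemma two_point_data_unique al be a v x y :
  two_point_data al be a v x -> two_point_data al be a v y -> x = y.
Proof.
move=> [hx xa xv] [hy ya yv]; move: xv yv; case: eqVneq => [_|/eqP ab] xv yv.
  by apply: (sol_unique hf (s := al) hx hy); rewrite ?xa ?ya ?xv ?yv.
by rewrite (sol_eq_dependence hx ab) (sol_eq_dependence hy ab) xa ya xv yv.
Qed.

Lemma two_point_data_existence al be a v : exists x, two_point_data al be a v x.
Proof.
rewrite /two_point_data; case: eqVneq => [_|/eqP ab].
  by have [x hx] := initial_value_existence al a v; exists x.
have [hx xa xb] := dependence_sol a (a + (be - al) *: v) ab.
by exists (fun t => F t al be a (a + (be - al) *: v)).
Qed.

(** The default of [xget] is never taken, by [two_point_data_existence]. *)
Definition data_sol (p : P4) : R -> vec :=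
  xget (fun=> 0) [set x | two_point_data p.1.1.1 p.1.1.2 p.1.2 p.2 x].

Lemma data_solP p : two_point_data p.1.1.1 p.1.1.2 p.1.2 p.2 (data_sol p).
Proof.
rewrite /data_sol; case: xgetP => // h.
by have [x hx] := two_point_data_existence p.1.1.1 p.1.1.2 p.1.2 p.2; case: (h x).
Qed.

Lemma data_sol_offdiag (al be : R) (a v : vec) t : al <> be ->
  data_sol (al, be, a, v) t = F t al be a (a + (be - al) *: v).
Proof.
move=> ab; have [hx xa] := data_solP (al, be, a, v); rewrite /= in hx xa *.
move/eqP/negbTE: (ab) => -> xb.
by rewrite {1}(sol_eq_dependence hx ab) xa xb.
Qed.

Definition extension (z : X5) : vec := data_sol (z.1.1.1.2, z.1.1.2, z.1.2, z.2) z.1.1.1.1.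

(** * The end value as an implicit function of the data *)

Section MeanVelocity.
Variable de : R.

(* By Hadamard's lemma this is the smooth extension to [be = al] of the difference
   quotient [(x be - x al) / (be - al)], [x] being the solution through [(al, a)]
   and [(de, c)]. *)
Definition mean_velocity (p : P4) : vec :=
  vint (fun s => G1 (p.1.1.1 + s * (p.1.1.2 - p.1.1.1), p.1.1.1, de, p.1.2, p.2)).

Lemma open_ne : open [set p : P4 | p.1.1.1 <> de].
Proof.
have oT : open [set: P4] by exact: openT.
rewrite (_ : [set p | _] = [set p : P4 | p.1.1.1 - de != 0]); last first.
  apply/seteqP; split=> z /=; first by move/eqP; rewrite subr_eq0.
  by rewrite subr_eq0 => /eqP.
apply: (@open_comp _ _ (fun z : P4 => z.1.1.1 - de) [set r : R | r != 0]).
  move=> z _; have h : MB 0 [set: P4] (fun z : P4 => z.1.1.1 - de) by mb oT.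
  exact: (MB_continuous h).
exact: open_neq0.
Qed.

Lemma MB_mean_velocity k : MB k [set p : P4 | p.1.1.1 <> de] mean_velocity.
Proof.
have oU := open_ne; apply: (MB_vint (G := fun z : R * P4 =>
  G1 (z.2.1.1.1 + z.1 * (z.2.1.1.2 - z.2.1.1.1), z.2.1.1.1, de, z.2.1.2, z.2.2)) oU).
have oTU : open ([set: R] `*` [set p : P4 | p.1.1.1 <> de]) by apply: openX => //; exact: openT.
(* The product with [z.1] is restated with the convertible [*:], which [mb] recognises. *)
apply: (MB_comp (f := fun z : R * P4 =>
  (z.2.1.1.1 + z.1 *: (z.2.1.1.2 - z.2.1.1.1), z.2.1.1.1, de, z.2.1.2, z.2.2))
  oTU (@open_offdiag R n) _ _ (MB_time_derive k)); first by move=> [s p] [].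
by mb oTU.
Qed.

Lemma mean_velocity_diag (al : R) (a c : vec) :
  mean_velocity (al, al, a, c) = G1 (al, al, de, a, c).
Proof.
rewrite /mean_velocity /= subrr.
rewrite (_ : (fun s => _) = fun=> G1 (al, al, de, a, c)) ?vint_cst//.
by apply/funext => s; rewrite mulr0 addr0.
Qed.

(** By the fundamental theorem of calculus [be - al] times the mean velocity is the increment of the
    solution. One equation for [c] thus describes the data on and off the diagonal. *)
Lemma mean_velocityP (al be : R) (a v c : vec) : al <> de ->
  mean_velocity (al, be, a, c) = v <-> two_point_data al be a v (fun t => F t al de a c).
Proof.
move=> ald; have [hx xa xb] := dependence_sol a c ald.
pose x (t : R) := F t al de a c.
have dx (t : R) : is_derive t 1 x (G1 (t, al, de, a, c)) by exact: dependence_derive.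
rewrite /two_point_data; case: eqVneq => [<-|/eqP ab].
  have -> : mean_velocity (al, al, a, c) = 'D_1 x al.
    by have [_ ->] := dx al; exact: mean_velocity_diag.
  by split=> [|[]].
have Q : (be - al) *: mean_velocity (al, be, a, c) = x be - a.
  have cg : cont (fun s => G1 (al + s * (be - al), al, de, a, c)).
    have oR : open [set: R] by exact: openT.
    have h : MB 0 [set: R] (fun s : R => G1 (al + s *: (be - al), al, de, a, c)).
      apply: (MB_comp (f := fun s : R => (al + s *: (be - al), al, de, a, c)) (g := G1)
        oR (@open_offdiag R n) _ _ (MB_time_derive 0)) => //.
      by mb oR.
    by move=> s; exact: (MB_continuous h).
  have cg' : cont (fun s => (be - al) *: G1 (al + s * (be - al), al, de, a, c)).
    by move=> s; apply: continuous_comp; [exact: cg|exact: scaler_continuous].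
  rewrite /mean_velocity /= -(vintZ _ cg).
  have dxs (s : R) : is_derive s 1 (fun s => x (al + s * (be - al)))
      ((be - al) *: G1 (al + s * (be - al), al, de, a, c)).
    apply: (is_derive_shiftP x al (be - al) s _).1.
    have := is_derive_dirZ (be - al) (dx (al + s * (be - al))).
    by rewrite [(be - al) *: 1]mulr1.
  by rewrite (vint_FTC cg' dxs) mul1r mul0r addr0 /x xa addrCA subrr addr0.
have ba : be - al != 0 by rewrite subr_eq0; apply/eqP => h; exact: ab.
split=> [<-|[_ _ xbe]].
  by split=> //; rewrite Q addrC subrK.
have := Q; rewrite [x be]xbe addrAC subrr add0r.
by move=> /(scalerI ba).
Qed.

Lemma data_sol_mean_velocity (al be : R) (a v c : vec) t : al <> de ->
  mean_velocity (al, be, a, c) = v -> data_sol (al, be, a, v) t = F t al de a c.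
Proof.
move=> ald /(mean_velocityP be a v c ald) h.
by rewrite (two_point_data_unique (data_solP (al, be, a, v)) h).
Qed.

Lemma mean_velocity_data_sol (al be : R) (a v : vec) : al <> de ->
  mean_velocity (al, be, a, data_sol (al, be, a, v) de) = v.
Proof.
move=> ald; have hd := data_solP (al, be, a, v); have [/= hx xa _] := hd.
apply/(mean_velocityP be a v _ ald).
by have := sol_eq_dependence hx ald; rewrite xa => <-.
Qed.

(** The map whose zeros define [c] implicitly: [z.1] holds the data [(al, be, a, v)] and [z.2] the
    end value at [de]. *)
Definition defect (z : P4 * vec) : vec := mean_velocity (z.1.1, z.2) - z.1.2.
Let O : set (P4 * vec) := [set z | z.1.1.1.1 <> de].

Let oO : open O.
Proof.
apply: (@open_comp _ _ (fun z : P4 * vec => z.1) [set p : P4 | p.1.1.1 <> de]).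
  by move=> z _; exact: (continuous_linear_fst _ _).2.
exact: open_ne.
Qed.

Lemma MB_defect k : MB k O defect.
Proof.
have oO' := oO; apply: MB_sub => //; last by mb oO'.
apply: (MB_comp (f := fun z : P4 * vec => (z.1.1, z.2)) oO' open_ne _ _ (MB_mean_velocity k)) => //.
by mb oO'.
Qed.

Lemma defect_injective (al : R) (a v c w : vec) : al < de ->
  'D_(0, w) defect ((al, al, a, v), c) = 0 -> w = 0.
Proof.
move=> ald h; apply: (@initial_velocity_injective al de a c w ald).
set z := ((al, al, a, v), c) in h.
have ne : al <> de by apply/eqP; rewrite lt_eqF.
have k : is_derive (z + 0 *: (0, w)) (0, w) defect 0.
  rewrite scale0r addr0 -h; apply: derivableP.
  by apply: (MB_derivable (MB_defect 1)); exact: ne.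
have {}k := (is_derive_shiftP defect z (0, w) 0 0).1 k.
have E (t : R) : defect (z + t *: (0, w)) = G1 (al, al, de, a, c + t *: w) - v.
  rewrite (_ : z + t *: (0, w) = ((al, al, a, v), c + t *: w)).
    by rewrite /defect mean_velocity_diag.
  by rewrite -[LHS]/((al, al, a, v) + t *: 0, c + t *: w) scaler0 addr0.
apply/is_derive_normP => e e0; have /is_derive_normP/(_ e e0) := k.
by apply: filterS => t; rewrite !E opprB addrA subrK.
Qed.

Let cP4 : compact_unit_ball P4.
Proof.
apply: compact_unit_ball_prod; last exact: compact_unit_ball_rV.
apply: compact_unit_ball_prod; last exact: compact_unit_ball_rV.
by apply: compact_unit_ball_prod; exact: compact_unit_ball_R.
Qed.

Let h (p : P4) : vec := data_sol p de.

Lemma defect0 (p : P4) : p.1.1.1 <> de -> defect (p, h p) = 0.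
Proof.
case: p => [[[al be] a] v] /= ald.
by rewrite /defect /= mean_velocity_data_sol// subrr.
Qed.

(** At a diagonal point [local_solvability] finds some zero of [defect] close to [h p], and
    uniqueness of the solution with given data forces it to be [h q]. Off the diagonal [h] is an
    explicit expression in [F]. *)
Lemma continuous_data_sol (p : P4) : p.1.1.1 < de -> {for p, continuous h}.
Proof.
case: p => [[[al be] a] v] /= ald; have ne : al <> de by apply/eqP; rewrite lt_eqF.
apply/continuous_normP => e e0.
have [beal|/eqP ab] := eqVneq be al.
  rewrite beal; set p := (al, al, a, v).
  have /near_normP[d d0 hd] := local_solvability (c0 := h p) (p0 := p) cP4 oO
    (MB_defect 1) ne (fun w => @defect_injective al a v (h p) w ald) (@defect0 p ne) e0.
  exists d => // q /hd[c cq [Oq Dq]].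
  suff -> : h q = c by [].
  case: q cq Oq Dq => [[[al' be'] a'] v'] cq Oq /eqP.
  rewrite /defect /= subr_eq0 => /eqP Dq.
  rewrite /h (data_sol_mean_velocity de Oq Dq).
  by have [_ _] := dependence_sol a' c Oq.
have oX := @open_offdiag R n.
pose g (q : P4) : X5 := (de, q.1.1.1, q.1.1.2, q.1.2, q.1.2 + (q.1.1.2 - q.1.1.1) *: q.2).
have oT : open [set: P4] by exact: openT.
have mg : MB 0 [set: P4] g by rewrite /g; mb oT.
have ne' : al <> be by move=> ?; exact: ab.
have cG : {for (al, be, a, v), continuous (fun q => G (g q))}.
  apply: (@continuous_comp _ _ _ g G); first exact: (MB_continuous mg).
  by apply: (MB_continuous (hF 0)); exact: ne'.
have /continuous_normP/(_ _ e0)[d1 d10 hd1] := cG.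
have : \forall q \near (al, be, a, v), @offdiag R n (g q).
  have cg := MB_continuous mg (I : [set: P4] (al, be, a, v)).
  exact: (cg _ (@open_near R X5 _ _ oX (ne' : @offdiag R n (g (al, be, a, v))))).
move=> /near_normP[d2 d20 hd2].
exists (Num.min d1 d2); first by rewrite lt_min d10.
move=> q; rewrite lt_min => /andP[/hd1 k1 /hd2 k2].
have E (r : P4) : offdiag (g r) -> h r = G (g r).
  by case: r => [[[al' be'] a'] v'] /= k; rewrite /h data_sol_offdiag.
by rewrite E// E.
Qed.

Lemma MB_data_sol k (p : P4) : p.1.1.1 = p.1.1.2 -> p.1.1.1 < de ->
  exists U : set P4, [/\ open U, U p, U `<=` [set q | q.1.1.1 <> de] & MB k.+1 U h].
Proof.
case: p => [[[al be] a] v] /= <- ald; set p := (al, al, a, v).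
have ne : al <> de by apply/eqP; rewrite lt_eqF.
have /near_normP[d d0 hd] := partial_bijective_near (c0 := h p) (p0 := p) cP4 oO
  (MB_defect 1) ne (fun w => @defect_injective al a v (h p) w ald).
have /continuous_normP/(_ _ d0)[d1 d10 hd1] := @continuous_data_sol p ald.
(* [d] and [d1] keep [(q, h q)] where the partial differential is bijective; [de - al] keeps the
   first time below [de], where [h] is known to be continuous. *)
pose r := Num.min d (Num.min d1 (de - al)).
have r0 : 0 < r by rewrite !lt_min d0 d10 subr_gt0.
pose U := [set q : P4 | `|q - p| < r].
have hU q : U q -> [/\ q.1.1.1 < de, `|q - p| < d & `|h q - h p| < d].
  rewrite /U /= !lt_min => /and3P[k1 k2 k3]; split=> //; last exact: hd1.
  move: k3; rewrite !prod_norm_lt => /andP[/andP[/andP[k3 _] _] _].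
  have := le_lt_trans (ler_norm _) k3.
  rewrite -[(q - p).1.1.1]/(q.1.1.1 - al); lra.
have bij q : U q -> [/\ O (q, h q),
    (forall w : vec, 'D_(0, w) defect (q, h q) = 0 -> w = 0) &
    (forall y : vec, exists w, 'D_(0, w) defect (q, h q) = y)].
  by move=> /hU[_ k1 k2]; apply: hd; rewrite prod_norm_lt /= k1 k2.
have oU : open U.
  apply: (@open_comp _ _ (fun q : P4 => `|q - p|) [set x | x < r]); last exact: open_lt.
  move=> q _; apply: (@continuous_comp _ _ _ (fun q : P4 => q - p) Num.norm); last first.
    exact: norm_continuous.
  exact: (MB_continuous (k := 0) (x := q) (MB_sub openT (MB_id 0 setT) (MB_cst 0 setT p))).
exists U; split=> //.
- by rewrite /U /= subrr normr0.
- by move=> q /bij[].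
apply: (implicit_MB cP4 (@compact_unit_ball_rV R n) oU oO _ (MB_defect k.+1)).
- by move=> q /bij[].
- by move=> q /bij[Oq _ _]; exact: defect0.
- by move=> q /hU[k1 _ _]; exact: continuous_data_sol.
- by move=> q w /bij[_ + _]; exact.
- by move=> q y /bij[_ _]; exact.
Qed.

End MeanVelocity.

Lemma MB_extension k : MB k [set: X5] extension.
Proof.
apply: MB_glue => z _; case: z => [[[[tau al] be] a] v].
have oX := @open_offdiag R n.
have [beal|/eqP ab] := eqVneq be al.
  (* The auxiliary time [al + 1] stays distinct from every starting time near [al]. *)
  have ald : al < al + 1 by rewrite ltrDl.
  have [//|U [oU Up neU hU]] := @MB_data_sol (al + 1) k (al, be, a, v) _ ald.
  pose pr (z : X5) : P4 := (z.1.1.1.2, z.1.1.2, z.1.2, z.2).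
  have oT : open [set: X5] by exact: openT.
  have mpr : MB 0 [set: X5] pr by rewrite /pr; mb oT.
  have oU' : open [set z | U (pr z)].
    by apply: (@open_comp _ _ pr U) => // z _; exact: (MB_continuous mpr).
  exists [set z | U (pr z)] => //.
  (* Rewriting the solution by its values at its starting time and at [al + 1] evaluates [F] off the
     diagonal even when the two given times coincide. *)
  pose g (z : X5) : X5 := (z.1.1.1.1, z.1.1.1.2, al + 1, z.1.2, data_sol (pr z) (al + 1)).
  apply: (@MB_eq _ k _ _ _ (fun z => G (g z)) extension oU').
    move=> [[[[t al'] be'] a'] v'] /= /neU /= ne.
    rewrite /extension /=.
    by rewrite (data_sol_mean_velocity t ne (mean_velocity_data_sol be' a' v' ne)).
  apply: (MB_comp (f := g) oU' oX _ _ (hF k)); first by move=> z /= /neU.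
  have mh : MB k [set z | U (pr z)] (fun z => data_sol (pr z) (al + 1)).
    apply: (MB_comp (f := pr) (g := fun p => data_sol p (al + 1)) oU' oU) => //.
      by rewrite /pr; mb oU'.
    exact: MB_S.
  by rewrite /g; mb oU'; exact: mh.
exists (@offdiag R n); first by move=> k'; exact: ab.
pose g (z : X5) : X5 :=
  (z.1.1.1.1, z.1.1.1.2, z.1.1.2, z.1.2, z.1.2 + (z.1.1.2 - z.1.1.1.2) *: z.2).
apply: (@MB_eq _ k _ _ _ (fun z => G (g z)) extension oX).
  by move=> [[[[t al'] be'] a'] v'] /= ne; rewrite /extension /= data_sol_offdiag.
apply: (MB_comp (f := g) oX oX _ _ (hF k)); first by move=> z.
by rewrite /g; mb oX.
Qed.

End Necessity.

Theorem mainTheorem3 (R : realType) (n : nat) (hn : (0 < n)%N)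
    (F : R -> R -> R -> 'rV[R]_n -> 'rV[R]_n -> 'rV[R]_n) :
  (exists f : R -> 'rV[R]_n -> 'rV[R]_n -> 'rV[R]_n,
      smooth (uncurry3 f) /\ N_solvable f /\ smooth_dependence F f)
  <->
  [/\ (forall (tau gamma delta alpha beta : R) (a b : 'rV[R]_n),
         alpha <> beta -> gamma <> delta ->
         F tau alpha beta a b =
         F tau gamma delta (F gamma alpha beta a b) (F delta alpha beta a b)),
      (forall (alpha beta : R) (a b : 'rV[R]_n), alpha <> beta ->
         F alpha alpha beta a b = a /\ F beta alpha beta a b = b) &
      (exists S : R * R * R * 'rV[R]_n * 'rV[R]_n -> 'rV[R]_n,
         smooth S /\
         forall (tau alpha beta : R) (a v : 'rV[R]_n), alpha <> beta ->
           S (tau, alpha, beta, a, v) = F tau alpha beta a (a + (beta - alpha) *: v))].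
Proof.
have cX : has_coordinates (R * R * R * 'rV[R]_n * 'rV[R]_n)%type.
  do 4 (apply: has_coordinates_prod; last by [exact: has_coordinates_R|exact: has_coordinates_rV]).
  exact: has_coordinates_R.
have cT : has_coordinates (R * 'rV[R]_n * 'rV[R]_n)%type.
  do 2 (apply: has_coordinates_prod; last exact: has_coordinates_rV).
  exact: has_coordinates_R.
split=> [[f [sf [Nf [dF sF]]]]|[F1 F2 [S [sS SF]]]].
  have hf : MB 1 [set: R * 'rV[R]_n * 'rV[R]_n] (uncurry3 f).
    by apply: Ck_on_MB => //; exact: openT.
  have hF k : MB k (@offdiag R n) (uncurry5 F).
    by apply: Ck_on_MB => //; exact: open_offdiag.
  split.
  - by move=> tau gamma delta alpha beta a b; exact: (dependence_consistent Nf dF).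
  - by move=> alpha beta a b ab; have [] := dependence_sol Nf dF a b ab.
  - exists (extension f); split.
      by move=> k; apply: MB_Ck_on; [exact: openT|exact: (MB_extension hf Nf dF hF)].
    by move=> tau alpha beta a v ab; exact: (data_sol_offdiag hf Nf dF hF).
have hS k : MB k [set: R * R * R * 'rV[R]_n * 'rV[R]_n] S.
  by apply: Ck_on_MB => //; exact: openT.
exists (ode_of_extension S); split.
  by move=> k; apply: MB_Ck_on; [exact: openT|exact: smooth_ode_of_extension].
split; first exact: (N_solvable_of_extension F1 F2 hS SF).
split; first exact: (dependence_of_extension F1 F2 hS SF).
exact: (smooth_offdiag_of_extension hS SF).
Qed.
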